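(* Let $\bm X=(X_1,\dots,X_p)^T$ be a random vector with mean $(\mu_1,\dots,\mu_p)^T$, covariance matrix $\Sigma_0$ and precision matrix $\Omega_0=\Sigma_0^{-1}$, and let $\bm X_1,\dots,\bm X_n$ be i.i.d. samples of $\bm X$ with sample covariance matrix $\Sigma_n$. Suppose $\Omega_0\in U=U(q,s_0(p))$ with $0\le q<1$, where $$U(q,s_0(p))=\Big\{\Omega=(\omega_{ij}):\ \Omega\succ 0,\ \|\Omega\|_{L_1}\le M,\ \max_{1\le i\le p}\sum_{j=1}^p|\omega_{ij}|^q\le s_0(p)\Big\}.$$ Assume (exponential-type tails) that there exists $0<\eta<1/4$ such that $\log p/n\le\eta$ and, for some constant $K<\infty$, $\mathrm{E}\,e^{t(X_i-\mu_i)^2}\le K$ for all $|t|\le\eta$ and all $i$. Let $C_0=2\eta^{-2}(2+\tau+\eta^{-1}e^2K^2)^2$ with $\tau$ sufficiently large, let $\lambda_n=C_0M\sqrt{\frac{\log p}{n}}<\frac1p-\varrho$ for some $\varrho>0$, and let $\gamma=\sqrt{\frac{\log p}{n}}$. Suppose $p\ge n^{\Xi}$ for some $\Xi\ge0$. Let $\rho\ge1$ and let $\hat\Omega_\gamma$ be the (symmetrized) GISS$^\rho$ estimator computed from $\Sigma_{n,\gamma}=\Sigma_n+\gamma I$ with stopping tolerance $\lambda_n$. Then $$\sup_{\Omega_0\in U}\mathrm{E}|\hat\Omega_\gamma-\Omega_0|_\infty^2=O\left(M^4\frac{\log p}{n}\right).$$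
   Context: Norms: for a matrix $A=(a_{ij})\in\mathbb{R}^{p\times p}$, $|A|_\infty=\max_{i,j}|a_{ij}|$ and $\|A\|_{L_1}=\max_{j}\sum_{i}|a_{ij}|$; for a vector $a$, $|a|_\infty=\max_j|a_j|$, $|a|_1=\sum_j|a_j|$, $|a|_2$ is the Euclidean norm. $A\succ0$ means positive definite. For $q=0$, $|\omega|^0$ is $1$ if $\omega\neq0$ and $0$ otherwise. Sample covariance: $\Sigma_n=\frac1{n-1}\sum_{k=1}^n(\bm X_k-\bar{\bm X})(\bm X_k-\bar{\bm X})^T$, $\bar{\bm X}=\frac1n\sum_k\bm X_k$. The dimension $p$ (and $M$) may depend on $n$; $O(\cdot)$ is as $n$ grows. GISS$^\rho$ algorithm with matrix $A\in\mathbb{R}^{p\times p}$, right-hand side $\bm e\in\mathbb{R}^p$, acceleration factor $\rho\ge1$ and tolerance $\lambda\ge0$. Initialize $\bm r_0=\bm e$, $t_1=1/|A^T\bm r_0|_\infty$, $\bm p(t_1)=t_1A^T\bm r_0$, $\tilde{\bm p}(t_1)=\bm p(t_1)$. For $k=1,2,\dots$, while the current residual satisfies $|\bm r|_\infty>\lambda$, do: 1. $I_k=\{i: |\tilde{\bm p}_i(t_k)|=1\}$. 2. $\bm\beta(t_k)$ is a minimizer of $|AP_{I_k}\bm\beta-\bm e|_2^2$, where $P_{I_k}$ is the coordinate projection onto the indices $I_k$ (so $\bm\beta(t_k)$ is supported on $I_k$). 3. $\bm r_k=\bm e-A\bm\beta(t_k)$. 4. $t_{k+1}=\rho\min\{t: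 t>t_k,\ \exists j:\ |\bm p_j(t)|=1,\ \bm\beta_j(t_k)=0,\ \bm p_j(t)\ne\bm p_j(t_k)\}$, where $\bm p_j(t)=\bm p_j(t_k)+(t-t_k)(A^T\bm r_k)_j$. 5. Set $\bm p(t_{k+1})$ by this formula with $t=t_{k+1}$, and $\tilde{\bm p}(t_{k+1})=\mathrm{sign}(\bm p(t_{k+1}))\min(|\bm p(t_{k+1})|,1)$ componentwise. The output is the last $\bm\beta(t_k)$, which satisfies $|A\bm\beta(t_k)-\bm e|_\infty\le\lambda$. GISS$^\rho$ estimator computed from $A$ with tolerance $\lambda$: for each $i=1,\dots,p$ let $\bm\beta_i$ be the output for right-hand side the $i$-th standard unit vector $\bm e_i$; let $\hat\Omega^1=(\omega_{ij})=[\bm\beta_1,\dots,\bm\beta_p]$; the estimator is the symmetrization $\hat\Omega=(\hat\omega_{ij})$ with $\hat\omega_{ij}=\hat\omega_{ji}=\omega_{ij}\mathbb{I}(|\omega_{ij}|\le|\omega_{ji}|)+\omega_{ji}\mathbb{I}(|\omega_{ij}|>|\omega_{ji}|)$, where $\mathbb{I}$ is the indicator function.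
   Formalization: The dimension is assumed to satisfy p ≥ 2 for all large n: for p = 1 one has log p = 0, so λ_n = γ = 0, the estimator is 1/Σ_n, and the claimed bound O(0) fails for every nondegenerate law. *)

(* Defs.v *)
From HB Require Import structures.
From mathcomp Require Import all_boot all_order all_algebra.
From mathcomp Require Import all_classical all_reals all_analysis.
Import Order.TTheory GRing.Theory Num.Theory.
Import numFieldNormedType.Exports.

Set Implicit Arguments.
Unset Strict Implicit.
Unset Printing Implicit Defensive.

Local Open Scope classical_set_scope.
Local Open Scope ring_scope.

(* For matrices and column vectors, `|A| is MathComp-Analysis's mx_norm, that
   is, the maximum of the absolute values of the entries. *)

Section MatrixClass.
Context {R : realType} {p : nat}.
Implicit Types A Omega : 'M[R]_p.

Definition normL1 A : R := \big[Num.max/0]_j \sum_i `|A i j|.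

Definition posdef A : Prop :=
  A^T = A /\ forall v : 'cV[R]_p, v != 0 -> 0 < (v^T *m A *m v) ord0 ord0.

(* powR satisfies 0 `^ 0 = 1, whereas here |0|^0 must be 0. *)
Definition abspow (q x : R) : R := if x == 0 then 0 else `|x| `^ q.

Definition precision_class (q s M : R) Omega : Prop :=
  [/\ posdef Omega, normL1 Omega <= M &
      forall i, \sum_j abspow q (Omega i j) <= s].

End MatrixClass.

Section GISS.
Context {R : realType} {p : nat}.
Variables (rho lambda : R) (A : 'M[R]_p).
Implicit Types (e b r v : 'cV[R]_p) (I : {set 'I_p}).

Definition sqnorm2 v : R := \sum_i v i ord0 ^+ 2.

Definition coord_proj I : 'M[R]_p := diag_mx (\row_i (i \in I)%:R).

Definition clip v : 'cV[R]_p :=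
  \col_i (Num.sg (v i ord0) * Num.min `|v i ord0| 1).

Definition saturated v : {set 'I_p} := [set i | `|clip v i ord0| == 1]%SET.

Definition ls_minimizer I e b : Prop :=
  (forall i, i \notin I -> b i ord0 = 0) /\
  forall b', sqnorm2 (A *m coord_proj I *m b - e)
             <= sqnorm2 (A *m coord_proj I *m b' - e).

Definition dual_path (tk : R) (pk r : 'cV[R]_p) (t : R) : 'cV[R]_p :=
  pk + (t - tk) *: (A^T *m r).

Definition hitting_times (tk : R) (pk b r : 'cV[R]_p) : set R :=
  [set t | tk < t /\ exists j, [/\ `|dual_path tk pk r t j ord0| = 1,
      b j ord0 = 0 & dual_path tk pk r t j ord0 <> pk j ord0]].

(* giss_loop e tk pk b: the loop entered at time tk with p(tk) = pk can end
   with output b. The residual is tested as soon as beta(tk) is known: when it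
   is 0, no component of p moves and t_(k+1) would be the minimum of the empty
   set. *)
Inductive giss_loop e : R -> 'cV[R]_p -> 'cV[R]_p -> Prop :=
| GissStop tk pk b :
    ls_minimizer (saturated pk) e b ->
    `|e - A *m b| <= lambda ->
    giss_loop e tk pk b
| GissStep tk pk b s out :
    ls_minimizer (saturated pk) e b ->
    lambda < `|e - A *m b| ->
    hitting_times tk pk b (e - A *m b) s ->
    lbound (hitting_times tk pk b (e - A *m b)) s ->
    giss_loop e (rho * s) (dual_path tk pk (e - A *m b) (rho * s)) out ->
    giss_loop e tk pk out.

(* If the loop is not entered at all, the output is taken to be 0. *)
Definition giss_output e b : Prop :=
  if `|e| <= lambda then b = 0
  else let t1 := `|A^T *m e|^-1 in giss_loop e t1 (t1 *: (A^T *m e)) b.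

(* The value 0 is a junk value for the case where the algorithm has no output.
   If A is invertible, then minimizers are unique and, for rho >= 1 and
   lambda >= 0, the algorithm terminates, because the saturated set grows
   strictly at each step. *)
Definition giss e : 'cV[R]_p := xget 0 [set b | giss_output e b].

Definition giss_columns : 'M[R]_p :=
  \matrix_(i, j) giss (delta_mx j ord0) i ord0.

(* The selection rule is applied to the pair (i, j) with i <= j and the result
   is used for both entries, so that the matrix is symmetric also when
   w_ij = - w_ji. *)
Definition min_symmetrize (W : 'M[R]_p) : 'M[R]_p :=
  \matrix_(i, j)
    let w := if (i <= j)%N then W i j else W j i in
    let w' := if (i <= j)%N then W j i else W i j in
    if `|w| <= `|w'| then w else w'.

Definition giss_estimator : 'M[R]_p := min_symmetrize giss_columns.

End GISS.

Section Sampling.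
Context {d : measure_display} {T : measurableType d} {R : realType}.
Variable P : probability T R.
Context {p : nat}.
Implicit Type X : {RV P >-> p.-tuple R}.

Definition coordinate X (i : 'I_p) (w : T) : R := tnth (X w) i.

Definition is_mean X (mu : 'cV[R]_p) : Prop :=
  forall i, ('E_P[coordinate X i] = (mu i ord0)%:E)%E.

Definition is_covariance X (Sigma : 'M[R]_p) : Prop :=
  forall i j, (covariance P (coordinate X i) (coordinate X j) = (Sigma i j)%:E)%E.

Definition is_precision X (Omega : 'M[R]_p) : Prop :=
  exists Sigma, [/\ is_covariance X Sigma, Sigma \in unitmx &
                    Omega = invmx Sigma].

Definition exp_tails X (mu : 'cV[R]_p) (eta K : R) : Prop :=
  forall (t : R) i, `|t| <= eta ->
    ('E_P[fun w => expR (t * (coordinate X i w - mu i ord0) ^+ 2)] <= K%:E)%E.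

Context {n : nat}.
Implicit Type Xs : 'I_n -> {RV P >-> p.-tuple R}.

Definition same_law X X' : Prop :=
  forall B : set (p.-tuple R), measurable B ->
    distribution P X B = distribution P X' B.

(* Some of the B k may be setT, so this is the product rule for all
   subfamilies. *)
Definition mutually_independent Xs : Prop :=
  forall B : 'I_n -> set (p.-tuple R), (forall k, measurable (B k)) ->
    P [set w | forall k, B k (Xs k w)] = (\prod_k P (Xs k @^-1` B k))%E.

Definition iid_sample X Xs : Prop :=
  (forall k, same_law (Xs k) X) /\ mutually_independent Xs.

Definition obs Xs (k : 'I_n) (w : T) : 'cV[R]_p := \col_i coordinate (Xs k) i w.

Definition sample_mean Xs (w : T) : 'cV[R]_p :=
  n%:R^-1 *: \sum_k obs Xs k w.

Definition sample_cov Xs (w : T) : 'M[R]_p :=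
  (n%:R - 1)^-1 *: \sum_k ((obs Xs k w - sample_mean Xs w)
                           *m (obs Xs k w - sample_mean Xs w)^T).

End Sampling.

(* The values of E|Omegahat_gamma - Omega0|^2 over all Omega0 in U(q, s) and
   all i.i.d. samples of size n from a p-dimensional law with precision matrix
   Omega0 and exponential-type tails with constants eta and K. *)
Definition giss_risks {R : realType} (n p : nat)
    (q s M eta K rho lambda gamma : R) : set (\bar R) :=
  [set risk | exists2 Omega0 : 'M[R]_p, precision_class q s M Omega0 &
    exists (d : measure_display) (T : measurableType d) (P : probability T R)
      (X : {RV P >-> p.-tuple R}) (mu : 'cV[R]_p)
      (Xs : 'I_n -> {RV P >-> p.-tuple R}),
    [/\ is_mean X mu, is_precision X Omega0, exp_tails X mu eta K,
        iid_sample X Xs &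
        risk = ('E_P[(fun w =>
          `|giss_estimator rho lambda (sample_cov Xs w + gamma%:M) - Omega0|
            ^+ 2)%R])%E]].

Definition tail_const {R : realType} (eta K tau : R) : R :=
  2 * eta ^- 2 * (2 + tau + eta^-1 * expR 1 ^+ 2 * K ^+ 2) ^+ 2.

Definition log_rate {R : realType} (p n : nat) : R := ln p%:R / n%:R.

(* Main.v *)
(** Write [r] for [sqrt (ln p / n)], [A] for the regularized sample covariance
    [Sigma_n + r I], [delta] for [|A - Sigma_0|] and [W] for the matrix of GISS
    outputs. As [A] is positive definite, each step of the loop enlarges the
    saturated set, so the loop stops and [|A W - I| <= lambda < 1/p].

    If [p M delta <= 1/2], then [A Omega_0 - I] has L1 norm at most 1/2, hence
    [A^-1] has L1 norm at most [2 M] and [W] at most [4 M], and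
    [W - Omega_0 = Omega_0 ((A W - I) - (A - Sigma_0) W)] gives
    [|W - Omega_0| <= M (4 M delta + lambda)]. In all cases coercivity gives
    [|W| <= 2 / r].

    [delta] is controlled by averages of the centered variables [Y_i] and
    [Y_i Y_j - Sigma_ij] with [Y = X - mu], whose moment generating functions
    satisfy a Chernoff bound. The squared error is dominated pointwise by a
    constant plus exponentials of these averages, so that no measurability of
    the estimator is needed. The event [p M delta > 1/2] has probability at most
    [4 p^2 exp (- u)] with [u] of order [n / (p M)^2]; since [p lambda < 1], [u]
    is at least a large multiple of [ln p], and half of the exponent pays for
    the powers of [p] while the other half, bounded by [16 / u^2] or [2 / u],
    turns [1 / r^2] and [M^2] into [M^4 r^2]. *)

Require Import Defs.
From HB Require Import structures.
From mathcomp Require Import all_boot all_order all_algebra.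
From mathcomp Require Import all_classical all_reals all_analysis.
From mathcomp Require Import measurable_realfun.
From mathcomp Require Import ring lra.
Import Order.TTheory GRing.Theory Num.Theory.
Import numFieldNormedType.Exports.
Set Implicit Arguments.
Unset Strict Implicit.
Unset Printing Implicit Defensive.

Local Open Scope classical_set_scope.
Local Open Scope ring_scope.

(** * Termination of GISS *)

Section EuclideanColumns.
Context {R : realType} {p : nat}.
Implicit Types (v w b : 'cV[R]_p) (A : 'M[R]_p).

Lemma sqnorm2E v : sqnorm2 v = (v^T *m v) ord0 ord0.
Proof. by rewrite mxE; apply: eq_bigr => i _; rewrite mxE expr2. Qed.

Lemma sqnorm2_ge0 v : 0 <= sqnorm2 v.
Proof. by apply: sumr_ge0 => i _; rewrite sqr_ge0. Qed.

Lemma sqnorm2_eq0 v : sqnorm2 v = 0 -> v = 0.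
Proof.
move=> /eqP; rewrite psumr_eq0 => [/allP v0|i _]; last exact: sqr_ge0.
apply/colP => i; rewrite mxE; apply/eqP; rewrite -sqrf_eq0.
by apply: v0; rewrite mem_index_enum.
Qed.

Lemma sqnorm2D v w :
  sqnorm2 (v + w) = sqnorm2 v + sqnorm2 w + 2 * (w^T *m v) ord0 ord0.
Proof.
rewrite [(w^T *m v) _ _]mxE /sqnorm2 mulr_sumr -!big_split /=; apply: eq_bigr => i _.
rewrite !mxE; ring.
Qed.

Lemma unitmx_inj A : (forall v, A *m v = 0 -> v = 0) -> A \in unitmx.
Proof.
move=> A0; rewrite -unitmx_tr -row_free_unit; apply: inj_row_free => v vA.
by apply: trmx_inj; rewrite trmx0; apply: A0; rewrite -[A]trmxK -trmx_mul vA trmx0.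
Qed.

End EuclideanColumns.

(** * Least squares restricted to a coordinate subspace *)

Section LeastSquares.
Context {R : realType} {p : nat}.
Variables (A : 'M[R]_p) (I : {set 'I_p}) (e : 'cV[R]_p).
Hypothesis uA : A \in unitmx.
Let P := @coord_proj R p I.

Lemma coord_projE (v : 'cV[R]_p) i :
  (P *m v) i ord0 = if i \in I then v i ord0 else 0.
Proof.
rewrite /P /coord_proj mul_diag_mx !mxE.
by case: (i \in I); rewrite ?mul1r ?mul0r.
Qed.

Lemma coord_projT : P^T = P.
Proof. by rewrite /P /coord_proj tr_diag_mx. Qed.

Lemma coord_proj_idem : P *m P = P.
Proof.
apply/matrixP => i j; rewrite /P /coord_proj mul_diag_mx !mxE.
by case: (i \in I); rewrite ?mul1r ?mul0r ?mul0rn.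
Qed.

(* The matrix [P A^T A P + (1 - P)] is invertible; the solution [b] of
   [(P A^T A P + (1 - P)) b = P A^T e] is supported on [I] and satisfies the
   normal equations. *)
Lemma ls_minimizer_exists : exists b, ls_minimizer A I e b /\
  forall i, i \in I -> (A^T *m (e - A *m b)) i ord0 = 0.
Proof.
have [B BE] : exists B, B = A *m P by eexists.
pose Q := 1%:M - P.
have QT : Q^T = Q by rewrite /Q linearB /= trmx1 coord_projT.
have QP : Q *m P = 0 by rewrite mulmxBl mul1mx coord_proj_idem subrr.
have QQ : Q *m Q = Q by rewrite {2}/Q mulmxBr mulmx1 QP subr0.
have BT : B^T = P *m A^T by rewrite BE trmx_mul coord_projT.
have uG : B^T *m B + Q \in unitmx.
  apply: unitmx_inj => v Gv.
  (* Pairing with [v] turns the equation into [|B v|^2 + |Q v|^2 = 0], so that [v = P v] and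
     [A v = B v = 0]. *)
  have : (v^T *m ((B^T *m B + Q) *m v)) ord0 ord0 = 0 by rewrite Gv mulmx0 mxE.
  rewrite mulmxDl mulmxDr mxE -{1}QQ -{1}QT -!mulmxA.
  rewrite [v^T *m (B^T *m _)]mulmxA [v^T *m (Q^T *m _)]mulmxA -!trmx_mul -!sqnorm2E.
  move=> /eqP; rewrite paddr_eq0 ?sqnorm2_ge0// => /andP[/eqP/sqnorm2_eq0 Bv /eqP/sqnorm2_eq0 Qv].
  have vP : v = P *m v by apply/eqP; rewrite -subr_eq0 -{1}[v]mul1mx -mulmxBl; apply/eqP.
  by rewrite -[v](mulKmx uA) vP (mulmxA A) -BE Bv mulmx0.
have [b Gb] : exists b, B^T *m (B *m b) + Q *m b = B^T *m e.
  by exists (invmx (B^T *m B + Q) *m (B^T *m e)); rewrite mulmxA -mulmxDl mulKVmx.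
have Qb : Q *m b = 0.
  have := congr1 (mulmx Q) Gb.
  have QBT : Q *m B^T = 0 by rewrite BT mulmxA QP mul0mx.
  by rewrite mulmxDr !(mulmxA Q) QBT !mul0mx add0r QQ.
have Pb : P *m b = b.
  by apply/esym/eqP; rewrite -subr_eq0 -{1}[b]mul1mx -mulmxBl; apply/eqP.
have NB : B^T *m (B *m b - e) = 0.
  by rewrite mulmxBr -Gb Qb addr0 subrr.
exists b; split; first split.
- by move=> i iI; rewrite -Pb coord_projE (negbTE iI).
- move=> b'; rewrite -/P -BE.
  (* Pythagoras: the cross term vanishes by the normal equations [NB]. *)
  have -> : B *m b' - e = (B *m b - e) + B *m (b' - b).
    by rewrite mulmxBr [RHS]addrC addrA subrK.
  rewrite [X in _ <= X]sqnorm2D trmx_mul -mulmxA NB mulmx0 [X in 2 * X]mxE mulr0 addr0.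
  by rewrite lerDl sqnorm2_ge0.
move=> i iI; have /(congr1 (fun M : 'cV[R]_p => M i ord0)) := NB.
rewrite BT -mulmxA coord_projE iI [RHS]mxE BE -mulmxA Pb => NBi.
by rewrite -opprB mulmxN mxE NBi oppr0.
Qed.

End LeastSquares.

(** * The dual path and the growth of the saturated set *)

Section Termination.
Context {R : realType} {p : nat}.
Variables (rho lambda : R) (A : 'M[R]_p).
Hypotheses (rho1 : 1 <= rho) (lambda0 : 0 <= lambda) (uA : A \in unitmx).
Implicit Types (e b pk : 'cV[R]_p).

(** Clipping gives modulus exactly 1 to every coordinate at or beyond the boundary, so coordinates
    that the factor [rho] carries past it count as well. *)
Lemma saturatedE pk i : (i \in saturated pk) = (1 <= `|pk i ord0|).
Proof.
rewrite inE mxE normrM.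
have [x0|x0] := eqVneq (pk i ord0) 0.
  by rewrite x0 sgr0 normr0 mul0r eq_sym oner_eq0 leNgt ltr01.
rewrite normr_sg x0 mul1r ger0_norm ?le_min ?normr_ge0 ?ler01//.
rewrite minEle; case: leP => h; first by rewrite eq_le h.
by rewrite eqxx (ltW h).
Qed.

(* The time at which a coordinate that is at [x] inside (-1, 1) at time [tk]
   and moves with slope [c] reaches the boundary. *)
Let hit (tk x c : R) := tk + (Num.sg c - x) / c.

(** A coordinate of constant slope [c] starting inside the interval can only leave it through
    [sg c], and passes there once. *)
Lemma hitP (tk x c : R) : `|x| < 1 -> c != 0 ->
  tk < hit tk x c /\ forall t, tk < t -> (`|x + (t - tk) * c| = 1 <-> t = hit tk x c).
Proof.
move=> x1 c0; rewrite /hit.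
have side (y : R) : `|y| = 1 -> y = 1 \/ y = -1.
  by case: (ger0P y) => _; [left|right; lra].
move: x1; rewrite ltr_norml => /andP[x1 x2].
have ci : c^-1 != 0 by rewrite invr_eq0.
case: (ltgtP c 0) (c0) => // cs _.
- rewrite ltr0_sg//; split.
    by rewrite ltrDl ltr_ndivlMr// mul0r; lra.
  move=> t tt; split => [/side h|->].
    have ct : (t - tk) * c < 0 by rewrite pmulr_rlt0// subr_gt0.
    have {h} h : x + (t - tk) * c = -1 by case: h; lra.
    by apply: (addIr (- tk)); rewrite addrAC subrr add0r -h addrAC subrr add0r mulfK.
  by rewrite [tk + _]addrC addrK divfK// addrC subrK normrN1.
- rewrite gtr0_sg//; split.
    by rewrite ltrDl ltr_pdivlMr// mul0r; lra.
  move=> t tt; split => [/side h|->].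
    have ct : 0 < (t - tk) * c by rewrite pmulr_rgt0// subr_gt0.
    have {h} h : x + (t - tk) * c = 1 by case: h; lra.
    by apply: (addIr (- tk)); rewrite addrAC subrr add0r -h addrAC subrr add0r mulfK.
  by rewrite [tk + _]addrC addrK divfK// addrC subrK normr1.
Qed.

(** After its hitting time a coordinate keeps moving outwards, so overshooting by the factor [rho]
    leaves it saturated. *)
Lemma hit_beyond (tk x c s : R) : c != 0 -> hit tk x c <= s ->
  1 <= `|x + (s - tk) * c|.
Proof.
move=> c0 hs.
have -> : x + (s - tk) * c = Num.sg c + (s - hit tk x c) * c.
  by rewrite /hit; field.
have : 0 <= s - hit tk x c by rewrite subr_ge0.
move: (s - _) => y y0.
case: (ltgtP c 0) (c0) => // cs _.
- rewrite ltr0_sg//; have : y * c <= 0 by rewrite mulr_ge0_le0// ltW.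
  by move: (y * c) => z z0; case: (ger0P (_ + z)) => ?; lra.
- rewrite gtr0_sg//; have : 0 <= y * c by rewrite mulr_ge0// ltW.
  by move: (y * c) => z z0; case: (ger0P (_ + z)) => ?; lra.
Qed.

(** Induction on the number of unsaturated coordinates. The normal equations give slope 0 to the
    saturated ones, which therefore stay saturated, and the first moving coordinate to hit the
    boundary joins them. Positivity of [tk] ensures [s <= rho * s]. *)
Lemma giss_loop_terminates e tk pk :
  0 < tk -> exists b, giss_loop rho lambda A e tk pk b.
Proof.
have [k] := ubnP #|~: saturated pk|%SET.
elim: k tk pk => // k IH tk pk sk tk0.
have [b [mb nb]] := ls_minimizer_exists (saturated pk) e uA.
have [le|lt] := leP `|e - A *m b| lambda.
  by exists b; exact: GissStop le.
have bI := mb.1; set r := e - A *m b in lt nb.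
(* A residual above [lambda] is nonzero, and so is its image under the invertible [A^T]. *)
have [j vj] : exists j, (A^T *m r) j ord0 != 0.
  apply/existsP; rewrite -[X in is_true X]negbK negb_exists; apply/negP => /forallP r0.
  have : A^T *m r = 0.
    by apply/colP => i; rewrite [RHS]mxE; apply/eqP; rewrite -[_ == _]negbK; exact: r0.
  move=> /(congr1 (mulmx (invmx A^T))).
  rewrite mulmx0 mulKmx ?unitmx_tr// => r00; move: lt.
  by rewrite r00 normr0 ltNge lambda0.
have out i : (A^T *m r) i ord0 != 0 -> i \notin saturated pk.
  by apply: contra => /nb ->.
have inside i : (A^T *m r) i ord0 != 0 -> `|pk i ord0| < 1.
  by move=> /out; rewrite saturatedE -ltNge.
have pathE t i : dual_path A tk pk r t i ord0 = pk i ord0 + (t - tk) * (A^T *m r) i ord0.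
  by rewrite /dual_path [LHS]mxE [X in _ + X]mxE.
(* The least of the finitely many hitting times of moving coordinates is the minimum of
   [hitting_times]. *)
case: (@Order.TotalTheory.arg_minP _ _ _ j (fun i => (A^T *m r) i ord0 != 0)
  (fun i => hit tk (pk i ord0) ((A^T *m r) i ord0)) vj) => i vi imin.
set s := hit _ _ _ in imin.
have [tks /(_ _ tks) [_ /(_ erefl) his]] := hitP tk (inside _ vi) vi.
have rs : s <= rho * s by rewrite ler_peMl// ltW// (lt_trans tk0).
have [||b' lb'] := IH (rho * s) (dual_path A tk pk r (rho * s)).
- apply: leq_trans (ltnSE sk) => /=; apply: proper_card.
  rewrite properE; apply/andP; split.
    rewrite finset.setCS; apply/fintype.subsetP => l lpk.
    by rewrite saturatedE pathE nb// mulr0 addr0 -saturatedE.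
  apply/fintype.subsetPn; exists i; rewrite inE ?out// negbK saturatedE pathE.
  exact: hit_beyond.
- by rewrite (lt_le_trans _ rs)// (lt_trans tk0).
exists b'; apply: GissStep mb lt _ _ lb'.
- split=> //; exists i; split; first by rewrite pathE.
    by apply: bI; exact: out.
  by move=> h; have := inside _ vi; rewrite -h pathE his ltxx.
- move=> t [tt [l [h1 bl]]].
  (* A motionless coordinate is excluded by the last clause of [hitting_times]. *)
  have [vl|vl] := eqVneq ((A^T *m r) l ord0) 0; first by rewrite pathE vl mulr0 addr0.
  move: h1; rewrite pathE => h1 _.
  by have [_ /(_ _ tt) [/(_ h1) -> _]] := hitP tk (inside _ vl) vl; apply: imin.
Qed.

Lemma giss_loop_residual e tk pk b :
  giss_loop rho lambda A e tk pk b -> `|e - A *m b| <= lambda.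
Proof. by elim. Qed.

(** Every output of the loop has passed the stopping test, whichever one [xget] picks, and
    termination excludes its default value when the loop is entered. *)
Lemma giss_residual e : `|e - A *m giss rho lambda A e| <= lambda.
Proof.
rewrite /giss; case: xgetP => [b _|no].
  rewrite /= /giss_output; case: ifPn => [le ->|_]; first by rewrite mulmx0 subr0.
  exact: giss_loop_residual.
rewrite mulmx0 subr0 leNgt; apply/negP => lt.
have [|b lb] := @giss_loop_terminates e `|A^T *m e|^-1 (`|A^T *m e|^-1 *: (A^T *m e)).
  rewrite invr_gt0 normr_gt0; apply/eqP => /(congr1 (mulmx (invmx A^T))).
  rewrite mulmx0 mulKmx ?unitmx_tr// => e0; move: lt.
  by rewrite e0 normr0 ltNge lambda0.
by apply: (no b); rewrite /= /giss_output leNgt lt.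
Qed.

End Termination.

(** * Approximate inverses *)

Section MatrixNorms.
Context {R : realType}.

Lemma mx_norm_le m n (A : 'M[R]_(m, n)) (x : R) :
  0 <= x -> (forall i j, `|A i j| <= x) -> `|A| <= x.
Proof.
move=> x0 Ax; rewrite [leLHS]/Num.Def.normr/= mx_normrE.
by apply: bigmax_le => // -[i j] _; exact: Ax.
Qed.

Lemma le_mx_norm m n (A : 'M[R]_(m, n)) i j : `|A i j| <= `|A|.
Proof.
rewrite [leRHS]/Num.Def.normr/= mx_normrE.
exact: (le_bigmax 0 (fun ij : 'I_m * 'I_n => `|A ij.1 ij.2|) (i, j)).
Qed.

Variable p : nat.
Implicit Types A B : 'M[R]_p.

Lemma normL1_ge0 A : 0 <= normL1 A.
Proof.
rewrite /normL1; elim/big_ind: _ => // [x y x0 y0|j _].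
  by rewrite le_max x0.
exact: sumr_ge0.
Qed.

Lemma col_sum_le_normL1 A j : \sum_i `|A i j| <= normL1 A.
Proof. exact: (le_bigmax 0 (fun j => \sum_i `|A i j|) j). Qed.

Lemma normL1_le A (x : R) :
  0 <= x -> (forall j, \sum_i `|A i j| <= x) -> normL1 A <= x.
Proof. by move=> x0 Ax; apply: bigmax_le => // j _; exact: Ax. Qed.

Lemma normL1_1 : normL1 (1%:M : 'M[R]_p) <= 1.
Proof.
apply: normL1_le => // j; rewrite (bigD1 j)//= mxE eqxx normr1 big1 ?addr0// => i ij.
by rewrite mxE (negbTE ij) normr0.
Qed.

Lemma normL1D A B : normL1 (A + B) <= normL1 A + normL1 B.
Proof.
apply: normL1_le => [|j]; first by rewrite addr_ge0 ?normL1_ge0.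
apply: (@le_trans _ _ (\sum_i (`|A i j| + `|B i j|))).
  by apply: ler_sum => i _; rewrite mxE ler_normD.
by rewrite big_split /= lerD ?col_sum_le_normL1.
Qed.

Lemma normL1N A : normL1 (- A) = normL1 A.
Proof. by rewrite /normL1; under eq_bigr do under eq_bigr do rewrite mxE normrN. Qed.

Lemma normL1M A B : normL1 (A *m B) <= normL1 A * normL1 B.
Proof.
apply: normL1_le => [|j]; first by rewrite mulr_ge0 ?normL1_ge0.
apply: (@le_trans _ _ (\sum_i \sum_k `|A i k| * `|B k j|)).
  apply: ler_sum => i _; rewrite mxE; apply: le_trans (ler_norm_sum _ _ _) _.
  by apply: ler_sum => k _; rewrite normrM.
rewrite exchange_big /=.
apply: (@le_trans _ _ (\sum_k normL1 A * `|B k j|)).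
  by apply: ler_sum => k _; rewrite -mulr_suml ler_wpM2r// col_sum_le_normL1.
by rewrite -mulr_sumr ler_wpM2l ?normL1_ge0// col_sum_le_normL1.
Qed.

Lemma normL1_le_mx_norm A : normL1 A <= p%:R * `|A|.
Proof.
apply: normL1_le => [|j]; first by rewrite mulr_ge0.
apply: (@le_trans _ _ (\sum_(i < p) `|A|)); first by apply: ler_sum => i _; exact: le_mx_norm.
by rewrite sumr_const card_ord mulr_natl.
Qed.

Lemma mx_norm_mulr A B : `|A *m B| <= `|A| * normL1 B.
Proof.
apply: mx_norm_le => [|i j]; first by rewrite mulr_ge0 ?normL1_ge0.
rewrite mxE; apply: le_trans (ler_norm_sum _ _ _) _.
apply: (@le_trans _ _ (\sum_k `|A| * `|B k j|)).
  by apply: ler_sum => k _; rewrite normrM ler_wpM2r// le_mx_norm.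
by rewrite -mulr_sumr ler_wpM2l// col_sum_le_normL1.
Qed.

(** The product involves row sums of [A], which symmetry turns into the column sums of [normL1]. *)
Lemma mx_norm_mull A B : A^T = A -> `|A *m B| <= normL1 A * `|B|.
Proof.
move=> sA; apply: mx_norm_le => [|i j]; first by rewrite mulr_ge0 ?normL1_ge0.
rewrite mxE; apply: le_trans (ler_norm_sum _ _ _) _.
apply: (@le_trans _ _ (\sum_k `|A k i| * `|B|)).
  apply: ler_sum => k _; rewrite normrM -{1}sA mxE.
  by rewrite ler_wpM2l// le_mx_norm.
by rewrite -mulr_suml ler_wpM2r// col_sum_le_normL1.
Qed.

End MatrixNorms.

(** * Perturbation of an inverse in L1 norm *)

Section Perturbation.
Context {R : realType} {p : nat}.
Variables (A S Om W : 'M[R]_p) (M lambda : R).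
Hypotheses (uA : A \in unitmx) (SOm : S *m Om = 1%:M) (sOm : Om^T = Om).
Hypotheses (OmM : normL1 Om <= M) (lambda0 : 0 <= lambda).
Hypotheses (lambdap : p%:R * lambda <= 1) (AW : `|A *m W - 1%:M| <= lambda).

Let M0 : 0 <= M. Proof. exact: le_trans (normL1_ge0 _) OmM. Qed.

(** With [F = A Om - 1 = (A - S) Om] one has [A^-1 = Om - A^-1 F]; since [F] has L1 norm at most
    1/2, the last term is absorbed by the left-hand side. *)
Lemma normL1_inverse_le : p%:R * (M * `|A - S|) <= 1 / 2 -> normL1 (invmx A) <= 2 * M.
Proof.
move=> small.
have nF : normL1 (A *m Om - 1%:M) <= 1 / 2.
  apply: le_trans (normL1_le_mx_norm _) _; apply: le_trans small.
  rewrite ler_wpM2l// -SOm -mulmxBl mulrC.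
  by apply: le_trans (mx_norm_mulr _ _) _; rewrite ler_wpM2l.
have invE : invmx A = Om - invmx A *m (A *m Om - 1%:M).
  by rewrite mulmxBr mulKmx// mulmx1 opprB addrC subrK.
have : normL1 (invmx A) <= M + normL1 (invmx A) * (1 / 2).
  rewrite {1}invE; apply: le_trans (normL1D _ _) _; rewrite normL1N lerD//.
  by apply: le_trans (normL1M _ _) _; rewrite ler_wpM2l ?normL1_ge0.
lra.
Qed.

Lemma approx_inverse_error : p%:R * (M * `|A - S|) <= 1 / 2 ->
  `|W - Om| <= M * (4 * M * `|A - S| + lambda).
Proof.
move=> small; have nV := normL1_inverse_le small.
have OmS : Om *m S = 1%:M by apply: mulmx1C.
(* Passing from the entrywise to the L1 norm costs a factor [p], which [p lambda <= 1] pays for. *)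
have nI : normL1 (A *m W) <= 2.
  rewrite -[A *m W](subrK 1%:M); apply: le_trans (normL1D _ _) _.
  rewrite -[2]/(1 + 1) lerD ?normL1_1//; apply: le_trans (normL1_le_mx_norm _) _.
  by apply: le_trans lambdap; rewrite ler_wpM2l.
have nW : normL1 W <= 4 * M.
  rewrite -(mulKmx uA W); apply: le_trans (normL1M _ _) _.
  have -> : 4 * M = 2 * M * 2 by ring.
  by rewrite ler_pM ?normL1_ge0.
have -> : W - Om = Om *m ((A *m W - 1%:M) - (A - S) *m W).
  have -> : (A *m W - 1%:M) - (A - S) *m W = S *m W - 1%:M.
    by rewrite mulmxBl opprB [LHS]addrC addrA subrK.
  by rewrite mulmxBr mulmx1 mulmxA OmS mul1mx.
apply: le_trans (mx_norm_mull _ sOm) _; rewrite ler_pM ?normL1_ge0//.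
apply: le_trans (ler_normB _ _) _; rewrite addrC lerD//.
apply: le_trans (mx_norm_mulr _ _) _; rewrite mulrC.
by rewrite ler_wpM2r.
Qed.

End Perturbation.

(** * Unconditional bound from coercivity *)

Section CrudeBound.
Context {R : realType} {p : nat}.
Variables (A : 'M[R]_p) (lambda gamma : R).
Hypotheses (gamma0 : 0 < gamma).
Hypothesis coercive : forall v : 'cV[R]_p, gamma * sqnorm2 v <= (v^T *m A *m v) ord0 ord0.

Lemma coercive_unitmx : A \in unitmx.
Proof.
apply: unitmx_inj => v Av; apply: sqnorm2_eq0; apply/eqP.
have := coercive v; rewrite -mulmxA Av mulmx0 mxE pmulr_rle0// => v0.
by rewrite eq_le v0 sqnorm2_ge0.
Qed.

Lemma coercive_entry_le (w : 'cV[R]_p) i : (gamma * w i ord0) ^+ 2 <= sqnorm2 (A *m w).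
Proof.
have wi : w i ord0 ^+ 2 <= sqnorm2 w.
  by rewrite /sqnorm2 (bigD1 i)//= lerDl sumr_ge0// => j _; rewrite sqr_ge0.
(* Young: [gamma |w|^2 <= <w, A w> <= gamma/2 |w|^2 + |A w|^2 / (2 gamma)] *)
have := sqnorm2_ge0 (A *m w - gamma *: w).
rewrite sqnorm2D -scaleN1r scalerA mulN1r.
have sqZ (a : R) (v : 'cV[R]_p) : sqnorm2 (a *: v) = a ^+ 2 * sqnorm2 v.
  by rewrite /sqnorm2 mulr_sumr; apply: eq_bigr => j _; rewrite mxE exprMn.
rewrite sqZ linearZ /= -scalemxAl mxE sqrrN mulmxA.
have := ler_wpM2l (ltW gamma0) (coercive w).
have := ler_wpM2l (sqr_ge0 gamma) wi.
rewrite exprMn.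
move: ((w^T *m A *m w) ord0 ord0) (sqnorm2 w) (sqnorm2 (A *m w)) => a b c.
rewrite !expr2; lra.
Qed.

(** Each column of [A W] is entrywise within [lambda] of a unit vector, so its squared Euclidean
    norm is at most [2 + 2 p lambda^2 <= 4]. *)
Lemma approx_inverse_crude (W : 'M[R]_p) :
  0 <= lambda -> p%:R * lambda <= 1 -> lambda <= 1 ->
  `|A *m W - 1%:M| <= lambda -> `|W| <= 2 / gamma.
Proof.
move=> l0 pl l1 AW; apply: mx_norm_le => [|i j]; first by rewrite divr_ge0 ?ltW.
have colE : A *m col j W = col j (A *m W) by rewrite !colE mulmxA.
have := coercive_entry_le (col j W) i.
have : sqnorm2 (A *m col j W) <= 4.
  rewrite colE; apply: (@le_trans _ _ (\sum_k (2 * (k == j)%:R + 2 * (lambda * lambda)))).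
    apply: ler_sum => k _.
    have : (A *m W - 1%:M) k j ^+ 2 <= lambda * lambda.
      rewrite -real_normK ?num_real// expr2 ler_pM//;
        exact: le_trans (le_mx_norm _ _ _) AW.
    rewrite [(A *m W - _) k j]mxE [(- 1%:M : 'M[R]_p) k j]mxE [(1%:M : 'M[R]_p) k j]mxE.
    rewrite [col _ _ _ _]mxE; move: ((A *m W) k j) => x.
    case: (k == j) => /=; rewrite ?mulr1n ?mulr0n !expr2; last by nra.
    by have := sqr_ge0 (x - 2); rewrite expr2; nra.
  rewrite big_split /= -mulr_sumr sumr_const card_ord (bigD1 j)//= eqxx big1 => [|k /negbTE -> //].
  rewrite addr0 mulr1 -mulr_natl.
  have : p%:R * lambda * lambda <= 1 * 1 by rewrite ler_pM// mulr_ge0.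
  nra.
move=> h1 h2; have {h1 h2} := le_trans h2 h1; rewrite mxE => h.
have : `|gamma * W i j| <= 2.
  by rewrite -(@ler_pXn2r _ 2)// ?nnegrE// real_normK ?num_real//; apply: le_trans h _; lra.
by rewrite normrM gtr0_norm// ler_pdivlMr// mulrC.
Qed.

End CrudeBound.

Section Symmetrization.
Context {R : realType} {p : nat}.

(** Each entry of the symmetrization is [W i j] or [W j i], and both approximate the same entry of
    the symmetric [Om]. *)
Lemma min_symmetrize_error (W Om : 'M[R]_p) :
  Om^T = Om -> `|min_symmetrize W - Om| <= `|W - Om|.
Proof.
move=> sOm; apply: mx_norm_le => // i j.
have e1 : `|W i j - Om i j| <= `|W - Om| by have := le_mx_norm (W - Om) i j; rewrite !mxE.
have e2 : `|W j i - Om i j| <= `|W - Om|.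
  by rewrite -{1}sOm; have := le_mx_norm (W - Om) j i; rewrite !mxE.
by rewrite !mxE /=; case: ifP => _; case: ifP.
Qed.

Lemma giss_columns_residual (rho lambda : R) (A : 'M[R]_p) :
  1 <= rho -> 0 <= lambda -> A \in unitmx ->
  `|A *m giss_columns rho lambda A - 1%:M| <= lambda.
Proof.
move=> rho1 l0 uA; apply: mx_norm_le => // i j.
have := le_trans (le_mx_norm _ i ord0) (giss_residual rho1 l0 uA (delta_mx j ord0)).
rewrite -normrN; congr (`|_| <= _); rewrite !mxE eqxx andbT opprB; congr (_ - _).
by apply: eq_bigr => k _; rewrite mxE.
Qed.

End Symmetrization.

(** * Expectations of products of independent variables *)

Section NonnegIntegrals.
Context {d : measure_display} {T : measurableType d} {R : realType}.
Local Open Scope ereal_scope.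

(* Unlike in ge0_le_integral, no measurability is needed: the integral of a
   nonnegative function is a supremum over the simple functions below it. *)
Lemma ge0_le_integral_nonmeasurable (mu : {measure set T -> \bar R})
    (f g : T -> \bar R) : (forall x, 0 <= f x) -> (forall x, f x <= g x) ->
  \int[mu]_x f x <= \int[mu]_x g x.
Proof.
move=> f0 fg; rewrite !ge0_integralTE// => [|x]; last exact: le_trans (fg x).
apply: le_ereal_sup => _ [h /= hf <-]; exists h => //= x.
exact: le_trans (hf x) (fg x).
Qed.

Import HBNNSimple.

(** * Product rule for integrals: from indicators to nonnegative functions *)

Section ProductIntegral.
Context {d' : measure_display} {T' : measurableType d'}.
Variables (P : {measure set T -> \bar R}) (H : T -> R) (X : T -> T') (c : R).
Hypotheses (mH : measurable_fun setT H) (H0 : (forall w, 0 <= H w)%R).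
Hypotheses (mX : measurable_fun setT X) (c0 : (0 <= c)%R).
Hypothesis indep : forall B, measurable B ->
  \int[P]_w (H w * \1_B (X w))%:E = c%:E * P (X @^-1` B).

(** A simple function is a finite combination of indicators, to each of which [indep] applies. *)
Let integral_mul_nnsfun (h : {nnsfun T' >-> R}) :
  \int[P]_w (H w * h (X w))%:E = c%:E * \int[P]_w (h (X w))%:E.
Proof.
have mB y : measurable (X @^-1` (h @^-1` [set y])).
  by rewrite -[X in measurable X]setTI; exact: mX.
have hE w : (h (X w))%:E =
    \sum_(y \in range h) (y%:E * (\1_(h @^-1` [set y]) (X w))%:E).
  by rewrite fimfunE -fsumEFin.
have mI y : measurable_fun setT (fun w => (\1_(h @^-1` [set y]) (X w))%:E : \bar R).
  by apply/measurable_EFinP/measurableT_comp.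
have I0 y w : 0 <= y%:E * (\1_(h @^-1` [set y]) (X w))%:E.
  exact: nnfun_muleindic_ge0.
under eq_integral do rewrite EFinM hE ge0_mule_fsumr//.
rewrite ge0_integral_fsum//; last 2 first.
- move=> y; apply: emeasurable_funM; first exact/measurable_EFinP.
  by apply: emeasurable_funM => //; exact: measurable_cst.
- by move=> y w _; rewrite mule_ge0// lee_fin.
under [in RHS]eq_integral do rewrite hE.
rewrite ge0_integral_fsum//; last first.
  by move=> y; apply: emeasurable_funM => //; exact: measurable_cst.
rewrite ge0_mule_fsumr; last by move=> y; apply: integral_ge0.
apply: eq_fsbigr => y _.
(* A negative [y] has empty preimage; for the others the coefficient can be taken out of a
   nonnegative integral. *)
have [y0|y0] := leP 0%R y; last first.
  have B0 : h @^-1` [set y] = set0.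
    by apply/seteqP; split => x //= hx; move: y0; rewrite -hx ltNge fun_ge0.
  rewrite B0; under eq_integral do rewrite indicE in_set0 !mule0.
  rewrite integral0; under eq_integral do rewrite indicE in_set0 !mule0.
  by rewrite integral0 mule0.
transitivity (y%:E * \int[P]_w (H w * \1_(h @^-1` [set y]) (X w))%:E).
  rewrite -ge0_integralZl_EFin//.
  - by apply: eq_integral => w _; rewrite [in RHS]EFinM muleCA.
  - by move=> w _; rewrite lee_fin mulr_ge0.
  - by apply/measurable_EFinP/measurable_funM => //; apply: measurableT_comp.
rewrite indep// ge0_integralZl_EFin// muleCA; congr (_ * (_ * _)).
by rewrite -[RHS]/(\int[P]_w (\1_(X @^-1` (h @^-1` [set y])) w)%:E) integral_indic// setIT.
Qed.

(** Monotone convergence on both sides along simple functions increasing to [f]. *)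
Lemma integral_mul_indep (f : T' -> R) :
  measurable_fun setT f -> (forall x, 0 <= f x)%R ->
  \int[P]_w (H w * f (X w))%:E = c%:E * \int[P]_w (f (X w))%:E.
Proof.
move=> mf f0; have mEf : measurable_fun setT (EFin \o f) by exact/measurable_EFinP.
pose f_ := nnsfun_approx measurableT mEf.
have cvf w : (f_ n (X w))%:E @[n --> \oo] --> (f (X w))%:E.
  by apply: (cvg_nnsfun_approx measurableT mEf) => // x _; rewrite lee_fin.
have ndf w : {homo (fun n => f_ n (X w)) : m n / (m <= n)%N >-> (m <= n)%R}.
  by move=> m n mn; exact/lefP/nd_nnsfun_approx.
have mfX n : measurable_fun setT (EFin \o (fun w => f_ n (X w))).
  by apply/measurable_EFinP/measurableT_comp.
transitivity (limn (fun n => \int[P]_w (H w * f_ n (X w))%:E)).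
  rewrite -monotone_convergence//=.
  - apply: eq_integral => w _; apply/esym/cvg_lim => //.
    under eq_fun do rewrite EFinM.
    by rewrite EFinM; apply: cvgeZl; [by []|exact: cvf].
  - move=> n; under eq_fun do rewrite EFinM.
    by apply: emeasurable_funM; [exact/measurable_EFinP|exact: mfX].
  - by move=> n w _; rewrite lee_fin mulr_ge0.
  - by move=> w _ m n mn; rewrite lee_fin ler_wpM2l// ndf.
have -> : \int[P]_w (f (X w))%:E = limn (fun n => \int[P]_w (f_ n (X w))%:E).
  rewrite -monotone_convergence//=; last by move=> w _ m n mn; rewrite lee_fin ndf.
  - by apply: eq_integral => w _; apply/esym/cvg_lim.
  - by move=> n w _; rewrite lee_fin.
rewrite -[RHS]limeMl//; last first.
  apply: ereal_nondecreasing_is_cvgn => m n mn; apply: ge0_le_integral.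
  - by [].
  - by move=> w _; rewrite lee_fin.
  - exact: mfX.
  - exact: mfX.
  - by move=> w _; rewrite lee_fin ndf.
by apply: congr_lim; apply/funext => n /=; exact: integral_mul_nnsfun.
Qed.

End ProductIntegral.
End NonnegIntegrals.

Section Independence.
Context {d : measure_display} {T : measurableType d} {R : realType}.
Variable P : probability T R.
Context {p n : nat}.
Variable Xs : 'I_n -> {RV P >-> p.-tuple R}.
Hypothesis indepXs : mutually_independent Xs.

Let measurable_factor (k : 'I_n) (f : p.-tuple R -> R) :
  measurable_fun setT f -> measurable_fun setT (fun w => f (Xs k w)).
Proof. by move=> mf; apply: measurableT_comp. Qed.

(** Induction from indicators, where the claim is the product rule for events; each step replaces
    one indicator by a general nonnegative factor. *)
Lemma integral_prod_indep (f : 'I_n -> p.-tuple R -> R) (m : 'I_n -> R) :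
  (forall k, measurable_fun setT (f k)) -> (forall k x, 0 <= f k x) ->
  (forall k, \int[P]_w (f k (Xs k w))%:E = (m k)%:E)%E ->
  (\int[P]_w (\prod_k f k (Xs k w))%:E = (\prod_k m k)%:E)%E.
Proof.
(* The factors of index at least [j] are indicators. *)
suff main j (g : 'I_n -> p.-tuple R -> R) (c : 'I_n -> R) :
    (forall k, measurable_fun setT (g k)) -> (forall k x, 0 <= g k x) ->
    (forall k, \int[P]_w (g k (Xs k w))%:E = (c k)%:E)%E ->
    (forall k : 'I_n, (j <= k)%N -> exists2 B, measurable B & g k = \1_B) ->
    (\int[P]_w (\prod_k g k (Xs k w))%:E = (\prod_k c k)%:E)%E.
  by move=> mf f0 fm; apply: (main n) => // k; rewrite leqNgt ltn_ord.
elim: j g c => [|j IH] g c mg g0 gc gB.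
  have [B BP] := choice (fun k => let: ex_intro2 B mB gE := gB k isT in
    ex_intro (fun B => measurable B /\ g k = \1_B) B (conj mB gE)).
  have mB k : measurable (B k) by have [] := BP k.
  have mXB k : measurable (Xs k @^-1` B k).
    by rewrite -[X in measurable X]setTI; exact: measurable_funP.
  have cE k : (c k)%:E = P (Xs k @^-1` B k).
    rewrite -gc; have [_ ->] := BP k.
    by rewrite -[LHS]/(\int[P]_w (\1_(Xs k @^-1` B k) w)%:E)%E integral_indic// setIT.
  have setE : [set w | forall k, B k (Xs k w)] = \bigcap_(k in [set: 'I_n]) (Xs k @^-1` B k).
    by apply/seteqP; split => [w h k _|w h k]; exact: (h k).
  have mE : measurable [set w | forall k, B k (Xs k w)].
    by rewrite setE; apply: fin_bigcap_measurable.
  rewrite -prodEFin; under [in RHS]eq_bigr do rewrite cE.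
  rewrite -indepXs// -[in RHS](setIT [set w | _]) -integral_indic//.
  apply: eq_integral => w _; congr EFin.
  rewrite indicE; have [/set_mem wB|/negP wB] := boolP (w \in _).
    by rewrite big1// => k _; have [_ ->] := BP k; rewrite indicE mem_set.
  have /existsNP[k kB] : ~ forall k, B k (Xs k w) by move=> h; apply: wB; rewrite inE.
  rewrite (bigD1 k)//=; have [_ ->] := BP k.
  by rewrite indicE memNset// mul0r.
have [jn|nj] := ltnP j n; last first.
  by apply: IH => // k jk; have := leq_trans nj jk; rewrite leqNgt ltn_ord.
pose k0 := Ordinal jn.
have c0 k : 0 <= c k by rewrite -lee_fin -gc; apply: integral_ge0 => w _; rewrite lee_fin.
transitivity (\int[P]_w ((\prod_(k | k != k0) g k (Xs k w)) * g k0 (Xs k0 w))%:E)%E.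
  by apply: eq_integral => w _; congr EFin; rewrite [LHS](bigD1 k0)//= mulrC.
rewrite (@integral_mul_indep _ _ _ _ _ _ _ _ (\prod_(k | k != k0) c k))//.
- by rewrite gc -EFinM; congr EFin; rewrite [RHS](bigD1 k0)//= mulrC.
- under eq_fun do rewrite big_mkcond.
  apply: measurable_prod => k _; case: (k != k0); last exact: measurable_cst.
  exact: measurable_factor.
- by move=> w; rewrite prodr_ge0.
move=> B mB.
have mXB : measurable (Xs k0 @^-1` B).
  by rewrite -[X in measurable X]setTI; exact: measurable_funP.
(* [integral_mul_indep] asks for the product rule with factor [k0] replaced by the indicator of [B],
   which is an instance of the induction hypothesis. *)
pose g' k := if k == k0 then \1_B else g k.
pose c' k := if k == k0 then fine (P (Xs k0 @^-1` B)) else c k.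
have cE : \prod_k c' k = (\prod_(k | k != k0) c k) * fine (P (Xs k0 @^-1` B)).
  rewrite (bigD1 k0)//= /c' eqxx mulrC; congr (_ * _).
  by apply: eq_bigr => k /negbTE ->.
have := IH g' c'; rewrite cE EFinM fineK ?fin_num_measure// => <-.
- apply: eq_integral => w _; congr EFin.
  rewrite [RHS](bigD1 k0)//= {1}/g' eqxx mulrC; congr (_ * _).
  by apply: eq_bigr => k /negbTE kk0; rewrite /g' kk0.
- by move=> k; rewrite /g'; case: ifP => // _; exact: measurable_indic.
- by move=> k x; rewrite /g'; case: ifP.
- move=> k; rewrite /g' /c'; case: eqP => [->|//].
  rewrite fineK ?fin_num_measure//.
  by rewrite -[LHS]/(\int[P]_w (\1_(Xs k0 @^-1` B) w)%:E)%E integral_indic// setIT.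
- move=> k jk; rewrite /g'; case: eqP => [_|/eqP kk0]; first by exists B.
  by apply: gB; rewrite ltn_neqAle jk andbT eq_sym.
Qed.

End Independence.

(** * Exponential moments *)

Section ExponentialInequalities.
Context {R : realType}.
Implicit Types x y z : R.

Lemma expR_le_quadratic y : expR y <= 1 + y + y ^+ 2 * expR `|y|.
Proof.
(* [exp y - 1 - y <= y (exp y - 1)], from [1 - y <= exp (- y)] *)
have h1 : expR y - 1 - y <= y * (expR y - 1).
  have := expR_ge1Dx (- y); rewrite expRN => h.
  have : (1 - y) * expR y <= 1.
    by rewrite -[leRHS](@mulVf _ (expR y)) ?gt_eqF ?expR_gt0// ler_wpM2r ?expR_ge0.
  lra.
have h2 := expR_ge1Dx y.
case: (ger0P y) => y0; last first.
  have e1 : 1 <= expR (- y) by have := expR_ge1Dx (- y); lra.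
  have : y ^+ 2 <= y ^+ 2 * expR (- y) by rewrite ler_peMr// sqr_ge0.
  have : y * (expR y - 1) <= y ^+ 2 by rewrite expr2; nra.
  lra.
have : y * (expR y - 1) <= y * (y * expR y).
  rewrite ler_wpM2l//.
  have := expR_ge1Dx (- y); rewrite expRN => h.
  have : (1 - y) * expR y <= 1.
    by rewrite -[leRHS](@mulVf _ (expR y)) ?gt_eqF ?expR_gt0// ler_wpM2r ?expR_ge0.
  lra.
rewrite mulrA -expr2; lra.
Qed.

Lemma sqr_le_expR z : 0 <= z -> z ^+ 2 <= 4 * expR z.
Proof.
move=> z0; have h := expR_ge1Dx (z / 2).
have -> : expR z = expR (z / 2) ^+ 2 by rewrite -expRM_natl mulrC divfK.
have : (z / 2) ^+ 2 <= expR (z / 2) ^+ 2.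
  by rewrite ler_pXn2r// ?nnegrE ?expR_ge0 ?divr_ge0//; lra.
rewrite !expr2; lra.
Qed.

Lemma expR_norm_le (s x : R) : expR (s * `|x|) <= expR (s * x) + expR (- s * x).
Proof.
case: (ger0P x) => _; first by rewrite lerDl expR_ge0.
by rewrite mulrN mulNr lerDr expR_ge0.
Qed.

End ExponentialInequalities.

Section ExponentialMoments.
Context {d : measure_display} {T : measurableType d} {R : realType}.
Variable P : probability T R.
Local Open Scope ereal_scope.

Lemma integrable_ge0_bounded (f : T -> R) (c : R) : measurable_fun setT f ->
  (forall w, 0 <= f w)%R -> \int[P]_w (f w)%:E <= c%:E ->
  P.-integrable setT (EFin \o f).
Proof.
move=> mf f0 fc; apply/integrableP; split; first exact/measurable_EFinP.
apply: le_lt_trans (ltry c); apply: le_trans fc.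
rewrite le_eqVlt; apply/orP; left; apply/eqP.
by apply: eq_integral => w _ /=; rewrite ger0_norm.
Qed.

Variables (W : T -> R) (h kappa : R).
Hypotheses (mW : measurable_fun setT W) (h0 : (0 < h)%R).
Hypothesis expW : \int[P]_w (expR (h * `|W w|))%:E <= kappa%:E.

Lemma measurable_expR_norm (a : R) : measurable_fun setT (fun w => expR (a * `|W w|)).
Proof.
apply: measurableT_comp; first exact: measurable_expR.
apply: measurable_funM => //.
exact: measurableT_comp.
Qed.

Lemma integrable_of_exp_moment : P.-integrable setT (EFin \o W).
Proof.
have iE := integrable_ge0_bounded (measurable_expR_norm h) (fun=> expR_ge0 _) expW.
apply: (le_integrable measurableT _ _ (integrableZl measurableT h^-1 iE)).
- exact/measurable_EFinP.
- move=> w _ /=; rewrite lee_fin [leRHS]ger0_norm ?mulr_ge0 ?invr_ge0 ?expR_ge0 ?(ltW h0)//.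
  rewrite [leRHS]mulrC ler_pdivlMr// mulrC; have := expR_ge1Dx (h * `|W w|); lra.
Qed.

Hypothesis EW0 : \int[P]_w (W w)%:E = 0.

(** Integrates [exp y <= 1 + y + y^2 exp |y|] at [y = s W], whose linear term has mean 0. As
    [|s| <= h / 2], one half of [exp (h |W|)] bounds [exp |y|] and the other half absorbs [y^2]. *)
Lemma centered_mgf_le (s : R) : (`|s| <= h / 2)%R ->
  \int[P]_w (expR (s * W w))%:E <= (expR (16 * kappa / h ^+ 2 * s ^+ 2))%:E.
Proof.
move=> sh; pose E w := expR (h * `|W w|); pose a : R := (16 / h ^+ 2 * s ^+ 2)%R.
have iE : P.-integrable setT (EFin \o E).
  exact: (integrable_ge0_bounded (measurable_expR_norm h) (fun=> expR_ge0 _) expW).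
have iW := integrable_of_exp_moment.
have a0 : (0 <= a)%R by rewrite /a mulr_ge0 ?sqr_ge0// divr_ge0// sqr_ge0.
have sW w : (`|s * W w| <= h / 2 * `|W w|)%R by rewrite normrM ler_wpM2r.
have iS : P.-integrable setT (EFin \o (fun w => expR (s * W w))).
  apply: (le_integrable measurableT _ _ iE).
    apply/measurable_EFinP/measurableT_comp; first exact: measurable_expR.
    exact: measurable_funM.
  move=> w _ /=; rewrite lee_fin !ger0_norm ?expR_ge0// ler_expR.
  apply: le_trans (ler_norm _) _; apply: le_trans (sW w) _.
  by rewrite ler_wpM2r// ler_pdivrMr// ler_pMr// ler1n.
have pw w : (expR (s * W w) <= 1 + s * W w + a * E w)%R.
  apply: le_trans (expR_le_quadratic _) _; rewrite lerD2l.
  have -> : E w = (expR (h / 2 * `|W w|) * expR (h / 2 * `|W w|))%R.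
    by rewrite -expRD; congr expR; field.
  rewrite mulrA ler_pM ?sqr_ge0 ?expR_ge0// ?ler_expR//.
  have : ((h / 2 * `|W w|) ^+ 2 <= 4 * expR (h / 2 * `|W w|))%R.
    by rewrite sqr_le_expR// mulr_ge0// divr_ge0// ltW.
  rewrite exprMn -[(`|W w| ^+ 2)%R]/_ real_normK ?num_real// => hW.
  have -> : ((s * W w) ^+ 2 = s ^+ 2 * (4 / h ^+ 2) * ((h / 2) ^+ 2 * W w ^+ 2))%R.
    by field; rewrite gt_eqF.
  have -> : (a * expR (h / 2 * `|W w|) =
      s ^+ 2 * (4 / h ^+ 2) * (4 * expR (h / 2 * `|W w|)))%R by rewrite /a; ring.
  by rewrite ler_wpM2l// mulr_ge0 ?sqr_ge0// divr_ge0// sqr_ge0.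
have i1 : P.-integrable setT (cst 1 \+ (fun w => s%:E * (W w)%:E)).
  apply: integrableD => //; last exact: integrableZl.
  exact: (finite_measure_integrable_cst P 1).
have i2 : P.-integrable setT (fun w => a%:E * (E w)%:E) by exact: integrableZl.
apply: (@le_trans _ _ (\int[P]_w ((cst 1 \+ (fun w => s%:E * (W w)%:E)) w + a%:E * (E w)%:E))).
  apply: le_integral => //; first exact: integrableD.
  by move=> w _; rewrite /= -!EFinM -!EFinD lee_fin.
rewrite (integralD measurableT i1 i2) (integralD measurableT).
- rewrite integral_cst// [X in 1 * X](_ : _ = 1) ?mul1e; last exact: probability_setT.
  rewrite (integralZl measurableT)//= EW0 mule0 adde0.
  rewrite (integralZl measurableT)//=.
  apply: (@le_trans _ _ (1 + a%:E * kappa%:E)).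
    by rewrite leeD2l// lee_wpmul2l// lee_fin.
  rewrite -EFinM -EFinD lee_fin.
  have -> : (16 * kappa / h ^+ 2 * s ^+ 2 = a * kappa)%R by rewrite /a; ring.
  exact: expR_ge1Dx.
- exact: (finite_measure_integrable_cst P 1).
- exact: integrableZl.
Qed.

End ExponentialMoments.

Lemma integral_probability_cst (d : measure_display) (T : measurableType d)
    (R : realType) (P : probability T R) (r : R) : (\int[P]_w r%:E = r%:E)%E.
Proof. by have := expectation_cst P r; rewrite unlock. Qed.

Section IidSums.
Context {d : measure_display} {T : measurableType d} {R : realType}.
Variable P : probability T R.
Context {p n : nat}.
Variables (X : {RV P >-> p.-tuple R}) (Xs : 'I_n -> {RV P >-> p.-tuple R}).

Lemma same_law_integral (X' : {RV P >-> p.-tuple R}) (f : p.-tuple R -> R) :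
  same_law X' X -> measurable_fun setT f -> (forall x, 0 <= f x) ->
  (\int[P]_w (f (X' w))%:E = \int[P]_w (f (X w))%:E)%E.
Proof.
move=> sl mf f0.
have mEf : measurable_fun setT (EFin \o f) by exact/measurable_EFinP.
have fE0 x : (0 <= (EFin \o f) x)%E by rewrite lee_fin.
rewrite -[LHS](ge0_integral_distribution X' mEf fE0).
rewrite -[RHS](ge0_integral_distribution X mEf fE0).
by apply: eq_measure_integral => B mB _; exact: sl.
Qed.

Hypothesis iidXs : iid_sample X Xs.
Variables (g : p.-tuple R -> R) (h kappa s : R).
Hypotheses (mg : measurable_fun setT g) (h0 : 0 < h) (sh : `|s| <= h / 2).
Hypothesis expg : (\int[P]_w (expR (h * `|g (X w)|))%:E <= kappa%:E)%E.
Hypothesis Eg0 : (\int[P]_w (g (X w))%:E = 0)%E.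

Let mgX : measurable_fun setT (fun w => g (X w)).
Proof. by apply: measurableT_comp. Qed.

(** The exponential of the sum is a product of independent factors with the same mean [m]. *)
Lemma iid_sum_mgf_le :
  (\int[P]_w (expR (s * \sum_k g (Xs k w)))%:E
   <= (expR (16 * kappa / h ^+ 2 * s ^+ 2 * n%:R))%:E)%E.
Proof.
have [law indep] := iidXs.
pose f x := expR (s * g x).
have mf : measurable_fun setT f.
  by apply: measurableT_comp; [exact: measurable_expR|exact: measurable_funM].
have f0 x : 0 <= f x by exact: expR_ge0.
have le1 := centered_mgf_le mgX h0 expg Eg0 sh.
pose m := fine (\int[P]_w (f (X w))%:E)%E.
have mE : (\int[P]_w (f (X w))%:E = m%:E)%E.
  rewrite fineK// ge0_fin_numE; first exact: le_lt_trans le1 (ltry _).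
  by apply: integral_ge0 => w _; rewrite lee_fin.
have m0 : 0 <= m by rewrite fine_ge0// integral_ge0// => w _; rewrite lee_fin.
have prodE := @integral_prod_indep _ _ _ _ _ _ _ indep (fun=> f) (fun=> m)
  (fun=> mf) (fun=> f0) (fun k => etrans (same_law_integral (law k) mf f0) mE).
under eq_integral do rewrite mulr_sumr expR_sum.
rewrite prodE lee_fin prodr_const card_ord mulr_natr -mulr_natl expRM_natl.
by rewrite lerXn2r ?nnegrE ?expR_ge0// -lee_fin -mE.
Qed.

End IidSums.

Lemma iid_abs_sum_mgf_le (d : measure_display) (T : measurableType d) (R : realType)
    (P : probability T R) (p n : nat) (X : {RV P >-> p.-tuple R})
    (Xs : 'I_n -> {RV P >-> p.-tuple R}) (g : p.-tuple R -> R) (h kappa s : R) :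
  iid_sample X Xs -> measurable_fun setT g -> 0 < h -> `|s| <= h / 2 ->
  (\int[P]_w (expR (h * `|g (X w)|))%:E <= kappa%:E)%E ->
  (\int[P]_w (g (X w))%:E = 0)%E ->
  (\int[P]_w (expR (s * `|\sum_k g (Xs k w)|))%:E
   <= (2 * expR (16 * kappa / h ^+ 2 * s ^+ 2 * n%:R))%:E)%E.
Proof.
move=> iid mg h0 sh expg Eg0.
have mS (a : R) : measurable_fun setT (fun w => (expR (a * \sum_k g (Xs k w)))%:E).
  apply/measurable_EFinP/measurableT_comp; first exact: measurable_expR.
  apply: measurable_funM => //; apply: measurable_sum => k.
  exact: measurableT_comp.
apply: (@le_trans _ _ (\int[P]_w ((expR (s * \sum_k g (Xs k w)))%:E
    + (expR (- s * \sum_k g (Xs k w)))%:E))%E).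
  apply: ge0_le_integral_nonmeasurable => w; first by rewrite lee_fin expR_ge0.
  by rewrite -EFinD lee_fin expR_norm_le.
rewrite ge0_integralD//; try by move=> w _; rewrite lee_fin expR_ge0.
rewrite mulr2n mulrDl mul1r EFinD leeD//; first exact: (iid_sum_mgf_le iid mg h0 sh expg Eg0).
rewrite -(sqrrN s); rewrite -normrN in sh.
exact: (iid_sum_mgf_le iid mg h0 sh expg Eg0).
Qed.

(** * Linear and quadratic deviations of one observation *)

Section Deviations.
Context {d : measure_display} {T : measurableType d} {R : realType}.
Variable P : probability T R.
Context {p : nat}.
Variables (X : {RV P >-> p.-tuple R}) (mu : 'cV[R]_p) (S : 'M[R]_p) (eta K : R).
Hypotheses (meanX : is_mean X mu) (covX : is_covariance X S).
Hypotheses (eta0 : 0 < eta) (tailX : exp_tails X mu eta K).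

Let Y i (x : p.-tuple R) := tnth x i - mu i ord0.

(** The optional second index collects [Y_i] and [Y_i Y_j - S_ij] in one finite family, so that both
    kinds are controlled by the same sums. *)
Definition deviation (a : 'I_p * option 'I_p) (x : p.-tuple R) : R :=
  if a.2 is Some j then Y a.1 x * Y j x - S a.1 j else Y a.1 x.

Let mY i : measurable_fun setT (Y i).
Proof. by apply: measurable_funB => //; exact: measurable_tnth. Qed.

Lemma measurable_deviation a : measurable_fun setT (deviation a).
Proof.
case: a => i [j|]; rewrite /deviation /=; last exact: mY.
by apply: measurable_funB => //; exact: measurable_funM.
Qed.

Let mYX i : measurable_fun setT (fun w => Y i (X w)).
Proof. by apply: measurableT_comp. Qed.

(** At [t = 0] the tail condition reads [1 <= K], as soon as there is a coordinate. *)
Lemma tail_const_ge1 : 'I_p -> 1 <= K.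
Proof.
move=> i; have := tailX i (t := 0).
rewrite normr0 => /(_ (ltW eta0)); rewrite unlock.
under eq_integral do rewrite mul0r expR0.
by rewrite integral_probability_cst lee_fin.
Qed.

(** From [|a b| <= (a^2 + b^2) / 2] and the inequality of arithmetic and geometric means for the two
    exponentials. *)
Lemma exp_product_moment i j :
  (\int[P]_w (expR (eta * `|Y i (X w) * Y j (X w)|))%:E <= K%:E)%E.
Proof.
have mE k : measurable_fun setT (fun w => (2^-1 * expR (eta * Y k (X w) ^+ 2))%:E).
  apply/measurable_EFinP/measurable_funM => //.
  apply: measurableT_comp; first exact: measurable_expR.
  by apply: measurable_funM => //; exact: measurable_funX.
have E0 k w : (0 <= (2^-1 * expR (eta * Y k (X w) ^+ 2))%:E)%E.
  by rewrite lee_fin mulr_ge0 ?expR_ge0.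
have tail k : (\int[P]_w (2^-1 * expR (eta * Y k (X w) ^+ 2))%:E <= (2^-1 * K)%:E)%E.
  have := tailX k (t := eta); rewrite ger0_norm ?(ltW eta0)// => /(_ (lexx _)); rewrite unlock => h.
  under eq_integral do rewrite EFinM.
  rewrite ge0_integralZl_EFin//; last first.
    apply/measurable_EFinP/measurableT_comp; first exact: measurable_expR.
    by apply: measurable_funM => //; exact: measurable_funX.
  by rewrite EFinM lee_wpmul2l// lee_fin.
apply: (@le_trans _ _ (\int[P]_w ((2^-1 * expR (eta * Y i (X w) ^+ 2))%:E
    + (2^-1 * expR (eta * Y j (X w) ^+ 2))%:E))%E).
  apply: ge0_le_integral_nonmeasurable => w; first by rewrite lee_fin expR_ge0.
  rewrite -EFinD lee_fin; move: (Y i _) (Y j _) => a b.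
  apply: (@le_trans _ _ (expR (eta * (a ^+ 2 / 2)) * expR (eta * (b ^+ 2 / 2)))).
    rewrite -expRD ler_expR -mulrDr ler_wpM2l ?(ltW eta0)//.
    have := sqr_ge0 (a - b); have := sqr_ge0 (a + b).
    by case: (ger0P (a * b)) => _; rewrite !expr2; nra.
  have expE c : expR (eta * c ^+ 2) = expR (eta * (c ^+ 2 / 2)) ^+ 2.
    by rewrite -expRM_natl; congr expR; field.
  rewrite !expE; move: (expR _) (expR _) => u v.
  have := sqr_ge0 (u - v); rewrite !expr2; lra.
rewrite ge0_integralD//.
apply: le_trans (leeD (tail i) (tail j)) _.
rewrite -EFinD lee_fin; lra.
Qed.

Lemma covariance_integral i j : (\int[P]_w (Y i (X w) * Y j (X w))%:E = (S i j)%:E)%E.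
Proof.
rewrite -covX [in RHS]unlock [in RHS](meanX i) [in RHS](meanX j) unlock.
by apply: eq_integral.
Qed.

(** Uses [|y| <= exp (eta |y|) / eta] under the integral. *)
Lemma covariance_abs_le i j : `|S i j| <= K / eta.
Proof.
have mYY : measurable_fun setT (fun w => (Y i (X w) * Y j (X w))%:E).
  by apply/measurable_EFinP/measurable_funM.
rewrite -lee_fin -[leLHS]/(`|(S i j)%:E|)%E -covariance_integral.
apply: le_trans (le_abse_integral _ measurableT mYY) _.
apply: (@le_trans _ _ (\int[P]_w (eta^-1%:E * (expR (eta * `|Y i (X w) * Y j (X w)|))%:E))%E).
  apply: ge0_le_integral_nonmeasurable => w //=.
  rewrite -EFinM lee_fin [leRHS]mulrC ler_pdivlMr// mulrC.
  apply: le_trans (expR_ge1Dx _); lra.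
rewrite ge0_integralZl_EFin//; last 2 first.
- apply/measurable_EFinP; apply: measurable_expR_norm; exact: measurable_funM.
- by rewrite invr_ge0 ltW.
rewrite mulrC EFinM lee_wpmul2l ?lee_fin ?invr_ge0 ?(ltW eta0)//.
exact: exp_product_moment.
Qed.

(** The factor in front of [K] pays for the centering by [S i j], bounded by [K / eta], and for the
    1 in [|y| <= 1 + y^2]. *)
Definition moment_const (eta K : R) : R := expR (eta * (1 + K / eta)) * K.

Lemma deviation_exp_moment a :
  (\int[P]_w (expR (eta * `|deviation a (X w)|))%:E <= (moment_const eta K)%:E)%E.
Proof.
(* For a linear deviation [j] is [i], so that it is compared with [Y_i^2]. *)
case: a => i o; pose j := odflt i o.
have K0 : 0 <= K by rewrite (le_trans ler01)// (tail_const_ge1 i).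
have Keta : 0 <= K / eta by rewrite divr_ge0// ltW.
have dev w : `|deviation (i, o) (X w)| <= 1 + K / eta + `|Y i (X w) * Y j (X w)|.
  rewrite /deviation /j; case: o {j} => [j|] /=.
    have := covariance_abs_le i j; have := ler_normB (Y i (X w) * Y j (X w)) (S i j); lra.
  rewrite normrM -expr2; move: (Y i (X w)) => y.
  by have := sqr_ge0 (`|y| - 1); have := normr_ge0 y; rewrite !expr2; nra.
apply: (@le_trans _ _ (\int[P]_w ((expR (eta * (1 + K / eta)))%:E
    * (expR (eta * `|Y i (X w) * Y j (X w)|))%:E))%E).
  apply: ge0_le_integral_nonmeasurable => w; first by rewrite lee_fin expR_ge0.
  by rewrite -EFinM lee_fin -expRD ler_expR -mulrDr ler_wpM2l ?(ltW eta0).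
rewrite ge0_integralZl_EFin ?expR_ge0//; last first.
  by apply/measurable_EFinP; apply: measurable_expR_norm; exact: measurable_funM.
rewrite /moment_const EFinM lee_wpmul2l ?lee_fin ?expR_ge0//.
exact: exp_product_moment.
Qed.

Lemma deviation_mean0 a : (\int[P]_w (deviation a (X w))%:E = 0)%E.
Proof.
have iY i j : P.-integrable setT (EFin \o (fun w => Y i (X w) * Y j (X w))).
  exact: (integrable_of_exp_moment (measurable_funM (mYX i) (mYX j)) eta0 (exp_product_moment i j)).
case: a => i [j|]; rewrite /deviation /=.
  under eq_integral do rewrite EFinB.
  rewrite (integralB_EFin measurableT (iY i j)
    (finite_measure_integrable_cst P (S i j) measurableT)).
  by rewrite covariance_integral integral_probability_cst subee.
have idev : P.-integrable setT (EFin \o (fun w => Y i (X w))).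
  exact: (integrable_of_exp_moment (mYX i) eta0 (deviation_exp_moment (i, None))).
have E1 : (\int[P]_w ((Y i (X w))%:E + (mu i ord0)%:E) = (mu i ord0)%:E)%E.
  rewrite -[RHS]meanX unlock; apply: eq_integral => w _.
  by rewrite /= -EFinD /Y /coordinate subrK.
have ic := finite_measure_integrable_cst P (mu i ord0) measurableT.
have := integralD_EFin measurableT idev ic.
rewrite /= E1 integral_probability_cst.
have := integrable_fin_num measurableT idev.
case: (\int[P]_x _)%E => //= r _; rewrite -EFinD => -[] h.
congr EFin; move: h; lra.
Qed.

Lemma deviation_sum_moment (n : nat) (Xs : 'I_n -> {RV P >-> p.-tuple R}) a (s : R) :
  iid_sample X Xs -> 0 <= s <= eta / 2 ->
  (\int[P]_w (expR (s * `|\sum_k deviation a (Xs k w)|))%:E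
   <= (2 * expR (16 * moment_const eta K / eta ^+ 2 * s ^+ 2 * n%:R))%:E)%E.
Proof.
move=> iid /andP[s0 se]; apply: iid_abs_sum_mgf_le iid _ eta0 _ _ _.
- exact: measurable_deviation.
- by rewrite ger0_norm.
- exact: deviation_exp_moment.
- exact: deviation_mean0.
Qed.

End Deviations.

(** * Risk bound *)

Section SampleCovariance.
Context {d : measure_display} {T : measurableType d} {R : realType}.
Variable P : probability T R.
Context {p n : nat}.
Variables (Xs : 'I_n -> {RV P >-> p.-tuple R}) (w : T).

Lemma sample_cov_coercive (gamma : R) (v : 'cV[R]_p) : (0 < n)%N ->
  gamma * sqnorm2 v <= (v^T *m (sample_cov Xs w + gamma%:M) *m v) ord0 ord0.
Proof.
move=> n0; rewrite mulmxDr mulmxDl mxE mul_mx_scalar -scalemxAl [X in _ <= _ + X]mxE.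
rewrite -sqnorm2E lerDr /sample_cov -scalemxAr -scalemxAl mxE mulr_ge0//.
  by rewrite invr_ge0 subr_ge0 ler1n.
rewrite mulmx_sumr mulmx_suml summxE sumr_ge0// => k _.
move: (obs _ _ _ - _) => u.
have -> : v^T *m (u *m u^T) *m v = (v^T *m u) *m (v^T *m u)^T.
  by rewrite trmx_mul trmxK !mulmxA.
by rewrite mxE big_ord1 [X in _ * X]mxE -expr2 sqr_ge0.
Qed.

Variables (mu : 'cV[R]_p) (S : 'M[R]_p).

(** Centering at the sample mean subtracts the product of the two sums over [n]; the isolated
    [S i j] is the difference between the [n] copies in the deviations and the normalization by
    [n - 1]. *)
Lemma sample_covE i j : (1 < n)%N ->
  sample_cov Xs w i j - S i j =
  (n%:R - 1)^-1 * (\sum_k deviation mu S (i, Some j) (Xs k w)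
    - (\sum_k deviation mu S (i, None) (Xs k w))
      * (\sum_k deviation mu S (j, None) (Xs k w)) / n%:R + S i j).
Proof.
move=> n1; have n0 : n%:R != 0 :> R by rewrite pnatr_eq0 -lt0n ltnW.
have n10 : n%:R - 1 != 0 :> R by rewrite subr_eq0 (eqr_nat R n 1) gtn_eqF.
pose y i (k : 'I_n) := tnth (Xs k w) i - mu i ord0.
have centered (l : 'I_p) (k : 'I_n) :
    (obs Xs k w - sample_mean Xs w) l ord0 = y l k - (\sum_k y l k) / n%:R.
  rewrite /obs /sample_mean /y !mxE summxE /coordinate.
  under eq_bigr do rewrite mxE.
  rewrite sumrB sumr_const card_ord -mulr_natr /coordinate.
  by field.
rewrite /sample_cov mxE summxE.
under eq_bigr do rewrite mxE big_ord1 [X in _ * X]mxE !centered.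
rewrite /deviation /= -/(y _ _).
have -> : \sum_k (y i k * y j k - S i j) = \sum_k y i k * y j k - n%:R * S i j.
  by rewrite sumrB sumr_const card_ord mulr_natl.
have -> : \sum_k (y i k - (\sum_k0 y i k0) / n%:R) * (y j k - (\sum_k0 y j k0) / n%:R) =
    \sum_k y i k * y j k - (\sum_k y i k) * (\sum_k y j k) / n%:R.
  have [a aE] : exists a, \sum_k y i k = a by eexists.
  have [b bE] : exists b, \sum_k y j k = b by eexists.
  rewrite aE bE.
  have -> : \sum_k (y i k - a / n%:R) * (y j k - b / n%:R) =
      \sum_k (y i k * y j k - b / n%:R * y i k - a / n%:R * y j k + a * b / n%:R ^+ 2).
    by apply: eq_bigr => k _; field.
  rewrite big_split /= !sumrB -!mulr_sumr aE bE sumr_const card_ord -mulr_natr.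
  by field.
by field; rewrite n0 n10.
Qed.

(** The product term is at most [n z^2 <= n z] as [z <= 1], and [n / (n - 1) <= 2]. *)
Lemma sample_cov_error (z s : R) i j : (1 < n)%N -> 0 <= z <= 1 -> `|S i j| <= s ->
  (forall a, `|\sum_k deviation mu S a (Xs k w)| <= n%:R * z) ->
  `|sample_cov Xs w i j - S i j| <= 4 * z + 2 * s / n%:R.
Proof.
move=> n1 /andP[z0 z1] Ss dev; rewrite sample_covE//.
have n2 : 2 <= n%:R :> R by rewrite (ler_nat R 2 n).
have n0 : 0 < n%:R :> R by apply: lt_le_trans n2.
have n10 : 0 < n%:R - 1 :> R by lra.
rewrite normrM ger0_norm ?invr_ge0 ?(ltW n10)// mulrC ler_pdivrMr//.
have := dev (i, Some j); have := dev (i, None); have := dev (j, None).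
set a := \sum_k deviation mu S (j, None) _; set b := \sum_k deviation mu S (i, None) _.
set c := \sum_k deviation mu S (i, Some j) _; move: a b c => a b c ha hb hc.
have hab : `|b * a / n%:R| <= n%:R * z.
  rewrite normrM normfV (gtr0_norm n0) ler_pdivrMr// normrM.
  apply: le_trans (ler_pM (normr_ge0 _) (normr_ge0 _) hb ha) _.
  have -> : n%:R * z * (n%:R * z) = n%:R * z * n%:R * z by ring.
  by rewrite ler_piMr// !mulr_ge0// ltW.
have h1 := ler_normD (c - b * a / n%:R) (S i j).
have h2 := ler_normB c (b * a / n%:R).
have s0 : 0 <= s by apply: le_trans Ss.
have : 2 * (n%:R * z) + s <= (4 * z + 2 * s / n%:R) * (n%:R - 1).
  have -> : (4 * z + 2 * s / n%:R) * (n%:R - 1) =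
    2 * (n%:R * z) + s + (2 * z + s / n%:R) * (n%:R - 2) by field; rewrite gt_eqF.
  rewrite lerDl mulr_ge0//; last lra.
  by rewrite addr_ge0// ?mulr_ge0// divr_ge0// ltW.
lra.
Qed.

End SampleCovariance.

Section EstimatorError.
Context {R : realType} {p : nat}.
Variables (A S Om : 'M[R]_p) (rho lambda gamma M : R).
Hypotheses (gamma0 : 0 < gamma) (rho1 : 1 <= rho) (lambda0 : 0 <= lambda).
Hypothesis coercive : forall v : 'cV[R]_p, gamma * sqnorm2 v <= (v^T *m A *m v) ord0 ord0.
Hypotheses (sOm : Om^T = Om) (OmM : normL1 Om <= M).
Hypotheses (lambdap : p%:R * lambda <= 1).

Let uA : A \in unitmx. Proof. exact: coercive_unitmx coercive. Qed.

Lemma giss_estimator_good : S *m Om = 1%:M ->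
  p%:R * (M * `|A - S|) <= 1 / 2 ->
  `|giss_estimator rho lambda A - Om| <= M * (4 * M * `|A - S| + lambda).
Proof.
move=> SOm small; apply: le_trans (min_symmetrize_error _ sOm) _.
by apply: approx_inverse_error => //; exact: giss_columns_residual.
Qed.

Lemma giss_estimator_crude : lambda <= 1 ->
  `|giss_estimator rho lambda A - Om| <= 2 / gamma + M.
Proof.
move=> lambda1; apply: le_trans (min_symmetrize_error _ sOm) _.
apply: le_trans (ler_normB _ _) _; apply: lerD.
  by apply: (approx_inverse_crude gamma0 coercive lambda0) => //; exact: giss_columns_residual.
apply: mx_norm_le => [|i j]; first exact: le_trans (normL1_ge0 _) OmM.
apply: le_trans OmM; apply: le_trans (col_sum_le_normL1 _ j).
by rewrite (bigD1 i)//= lerDl sumr_ge0.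
Qed.

End EstimatorError.

(** * Numerical inequalities *)

Section Numerics.
Context {R : realType}.

(** Lets powers of [1 / ln p] be absorbed into constants. It follows from [exp (- 1/2) >= 1/2]. *)
Lemma ln_nat_ge_half (p : nat) : (2 <= p)%N -> 1 / 2 <= ln p%:R :> R.
Proof.
move=> p2; apply: (@le_trans _ _ (ln 2)); last first.
  by rewrite ler_ln ?posrE ?ltr0n ?(ltnW p2)// (ler_nat R 2 p).
rewrite -ler_expR lnK ?posrE//.
have := expR_ge1Dx (- (1 / 2) : R); rewrite expRN => h.
have e0 := expR_gt0 (1 / 2 : R).
have : (1 / 2) * expR (1 / 2) <= 1 :> R.
  rewrite -[leRHS](@mulVf _ (expR (1 / 2))) ?gt_eqF// ler_wpM2r ?expR_ge0//; lra.
lra.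
Qed.

(** Let [u] be [S / n] in units of [r]. If [u > B], then [u^2 <= 2 B^2 + 2 (u - B)^2] and the last
    square is dominated by an exponential. The level [B] buys the factor [exp (- b l B)], which
    later pays for the number of deviations. *)
Lemma sqr_le_exp_tilt (r l b B S n : R) :
  0 < r -> 0 < n -> r ^+ 2 * n = l -> 0 < l -> 0 < b -> 0 <= B -> 0 <= S ->
  (S / n) ^+ 2 <= r ^+ 2 * (2 * B ^+ 2
    + 8 / (b * l) ^+ 2 * expR (- (b * l * B)) * expR (b * r * S)).
Proof.
move=> r0 n0 rn l0 b0 B0 S0; pose u := S / (n * r).
have u0 : 0 <= u by rewrite divr_ge0// ltW// mulr_gt0.
have -> : S / n = r * u by rewrite /u; field; rewrite !gt_eqF.
have -> : b * r * S = b * l * u by rewrite /u -rn; field; rewrite !gt_eqF.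
rewrite exprMn ler_wpM2l ?sqr_ge0// -mulrA -expRD.
have bl : 0 < b * l by rewrite mulr_gt0.
have e0 : 0 <= 8 / (b * l) ^+ 2 * expR (- (b * l * B) + b * l * u).
  by rewrite mulr_ge0 ?expR_ge0// divr_ge0// sqr_ge0.
have [uB|Bu] := leP u B.
  have : u ^+ 2 <= B ^+ 2 by rewrite ler_pXn2r// nnegrE.
  by have := sqr_ge0 B; lra.
have : (b * l * (u - B)) ^+ 2 <= 4 * expR (b * l * (u - B)).
  by apply: sqr_le_expR; rewrite mulr_ge0// ltW// subr_gt0.
have -> : - (b * l * B) + b * l * u = b * l * (u - B) by ring.
rewrite exprMn mulrC -ler_pdivlMr ?exprn_gt0// => h.
have : 8 / (b * l) ^+ 2 * expR (b * l * (u - B)) =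
  2 * (4 * expR (b * l * (u - B)) / (b * l) ^+ 2) by ring.
move=> ->; have := sqr_ge0 (u - 2 * B); move: h; rewrite !expr2; lra.
Qed.

(** [q] stands for the dimension. As [u >= 12 l], half of the exponent gives [q^-6]: [q^2] cancels
    the explicit prefactor and [q^4] covers the powers of [q] in [1 / u^2] and [1 / u]. *)
Lemma bad_event_numerics (n q M r l G u : R) :
  0 < n -> expR l = q -> 0 < r -> r ^+ 2 * n = l -> 1 / 2 <= l ->
  0 < G -> 0 < M -> u = n / (G * q ^+ 2 * M ^+ 2) -> 12 * l <= u ->
  (8 / r ^+ 2 + 2 * M ^+ 2) * (4 * q ^+ 2 * expR (- u))
    <= (2048 * G ^+ 2 + 32 * G) * (M ^+ 4 * r ^+ 2).
Proof.
move=> n0 ql r0 rn l12 G0 M0 uE u12.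
have q0 : 0 < q by rewrite -ql expR_gt0.
have q1 : 1 <= q by rewrite -ql -expR0 ler_expR; lra.
have u0 : 0 < u by lra.
pose t := expR (- (u / 2)).
have t0 : 0 < t by exact: expR_gt0.
have tV : t * expR (u / 2) = 1 by rewrite -expRD addNr expR0.
have t1 : t <= 2 / u.
  rewrite ler_pdivlMr//; have := expR_ge1Dx (u / 2) => h.
  have : t * (1 + u / 2) <= 1 by rewrite -[leRHS]tV ler_wpM2l// ltW.
  nra.
have t2 : t <= 16 / u ^+ 2.
  rewrite ler_pdivlMr ?exprn_gt0//.
  have h : (u / 2) ^+ 2 <= 4 * expR (u / 2) by rewrite sqr_le_expR// divr_ge0// ltW.
  have : t * (u / 2) ^+ 2 <= t * (4 * expR (u / 2)) by rewrite ler_wpM2l// ltW.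
  have -> : t * (4 * expR (u / 2)) = 4 by rewrite mulrCA tV mulr1.
  rewrite !expr2; lra.
have eu : expR (- u) <= (q ^+ 6)^-1 * t.
  have -> : - u = - (u / 2) + - (u / 2) by field.
  rewrite expRD ler_wpM2r ?(ltW t0)// -ql -expRM_natl -expRN ler_expR; lra.
have nV : n^-1 <= 2 * r ^+ 2.
  have -> : n^-1 = r ^+ 2 / l by rewrite -rn; field; rewrite !gt_eqF.
  rewrite mulrC ler_wpM2r ?sqr_ge0//.
  rewrite -[leRHS]invrK lef_pV2 ?posrE ?invr_gt0//; lra.
apply: (@le_trans _ _ ((8 / r ^+ 2 + 2 * M ^+ 2) * (4 / q ^+ 4 * t))).
  rewrite ler_wpM2l ?addr_ge0 ?divr_ge0 ?mulr_ge0 ?(ltW r0) ?(ltW M0)//.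
  have -> : 4 / q ^+ 4 * t = 4 * q ^+ 2 * ((q ^+ 6)^-1 * t) by field; rewrite gt_eqF.
  by rewrite ler_wpM2l// mulr_ge0// sqr_ge0.
rewrite mulrDl [leRHS]mulrDl lerD//.
  apply: (@le_trans _ _ (8 / r ^+ 2 * (4 / q ^+ 4 * (16 / u ^+ 2)))).
    by rewrite !ler_wpM2l// ?divr_ge0 ?exprn_ge0 ?(ltW q0) ?(ltW r0).
  have -> : 8 / r ^+ 2 * (4 / q ^+ 4 * (16 / u ^+ 2)) =
      512 * G ^+ 2 * M ^+ 4 * (r ^+ 2 * (l^-1) ^+ 2).
    by rewrite uE -rn; field; rewrite !gt_eqF.
  have l2 : (l^-1) ^+ 2 <= 4.
    have -> : 4 = 2 ^+ 2 :> R by rewrite expr2; ring.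
    rewrite ler_pXn2r ?nnegrE ?invr_ge0//; last lra.
    rewrite -[leRHS]invrK lef_pV2 ?posrE ?invr_gt0//; lra.
  have -> : 2048 * G ^+ 2 * (M ^+ 4 * r ^+ 2) = 512 * G ^+ 2 * M ^+ 4 * (r ^+ 2 * 4) by ring.
  apply: ler_wpM2l; last by apply: ler_wpM2l => //; exact: sqr_ge0.
  apply: mulr_ge0; last by apply: exprn_ge0; exact: ltW.
  by apply: mulr_ge0; [exact: ler0n|exact: sqr_ge0].
apply: (@le_trans _ _ (2 * M ^+ 2 * (4 / q ^+ 4 * (2 / u)))).
  by rewrite !ler_wpM2l// ?divr_ge0 ?mulr_ge0 ?exprn_ge0 ?(ltW q0) ?(ltW M0).
have -> : 2 * M ^+ 2 * (4 / q ^+ 4 * (2 / u)) = 16 * G * M ^+ 4 * ((q ^+ 2)^-1 * n^-1).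
  by rewrite uE; field; rewrite !gt_eqF.
have -> : 32 * G * (M ^+ 4 * r ^+ 2) = 16 * G * M ^+ 4 * (2 * r ^+ 2) by ring.
rewrite ler_wpM2l ?mulr_ge0 ?exprn_ge0 ?(ltW G0) ?(ltW M0)//.
apply: le_trans nV; rewrite ler_piMl ?invr_ge0 ?(ltW n0)//.
by rewrite invf_le1 ?exprn_gt0// exprn_ege1.
Qed.

End Numerics.

(** Measurability is asked of the dominating functions; [f] will be the squared error of the
    estimator. *)
Lemma integral_le_sum2 (d : measure_display) (T : measurableType d) (R : realType)
    (P : probability T R) (I : finType) (f : T -> R) (F1 F2 : I -> T -> R)
    (k0 k1 k2 m1 m2 : R) :
  0 <= k0 -> 0 <= k1 -> 0 <= k2 ->
  (forall i, measurable_fun setT (F1 i)) -> (forall i, measurable_fun setT (F2 i)) ->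
  (forall i w, 0 <= F1 i w) -> (forall i w, 0 <= F2 i w) ->
  (forall i, \int[P]_w (F1 i w)%:E <= m1%:E)%E ->
  (forall i, \int[P]_w (F2 i w)%:E <= m2%:E)%E ->
  (forall w, 0 <= f w) ->
  (forall w, f w <= k0 + k1 * (\sum_i F1 i w) + k2 * (\sum_i F2 i w)) ->
  (\int[P]_w (f w)%:E <= (k0 + k1 * (#|I|%:R * m1) + k2 * (#|I|%:R * m2))%:E)%E.
Proof.
move=> k00 k10 k20 mF1 mF2 F10 F20 h1 h2 f0 fle.
have int_sum (F : I -> T -> R) (k m : R) : 0 <= k ->
    (forall i, measurable_fun setT (F i)) -> (forall i w, 0 <= F i w) ->
    (forall i, \int[P]_w (F i w)%:E <= m%:E)%E ->
    (\int[P]_w (k * \sum_i F i w)%:E <= (k * (#|I|%:R * m))%:E)%E.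
  move=> k0' mF F0 h.
  have mE i : measurable_fun setT (fun w => (F i w)%:E) by exact/measurable_EFinP.
  have E0 i w : [set: T] w -> (0 <= (F i w)%:E)%E by rewrite lee_fin.
  under eq_integral do rewrite EFinM -sumEFin.
  rewrite ge0_integralZl_EFin//; last 2 first.
  - by move=> w _; rewrite sume_ge0// => i _; exact: E0.
  - exact: emeasurable_sum.
  rewrite EFinM lee_wpmul2l ?lee_fin// (ge0_integral_sum P measurableT mE E0).
  apply: (@le_trans _ _ (\sum_(i : I) m%:E)%E); first exact: lee_sum.
  by rewrite sumEFin lee_fin sumr_const mulr_natl.
have mS (F : I -> T -> R) (k : R) : (forall i, measurable_fun setT (F i)) ->
    measurable_fun setT (fun w => (k * \sum_i F i w)%:E).
  by move=> mF; apply/measurable_EFinP/measurable_funM => //; exact: measurable_sum.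
have S0 (F : I -> T -> R) (k : R) w : 0 <= k -> (forall i w, 0 <= F i w) ->
    (0 <= (k * \sum_i F i w)%:E)%E.
  by move=> k0' F0; rewrite lee_fin mulr_ge0// sumr_ge0.
apply: (@le_trans _ _ (\int[P]_w (k0%:E + ((k1 * \sum_i F1 i w)%:E
    + (k2 * \sum_i F2 i w)%:E)))%E).
  apply: ge0_le_integral_nonmeasurable => w; first by rewrite lee_fin.
  by rewrite -!EFinD lee_fin addrA.
rewrite ge0_integralD//; last 2 first.
- by move=> w _; rewrite adde_ge0// S0.
- by apply: emeasurable_funD; exact: mS.
rewrite ge0_integralD//; last 4 first.
- by move=> w _; exact: S0.
- exact: mS.
- by move=> w _; exact: S0.
- exact: mS.
rewrite integral_probability_cst -(addrA k0) 2!EFinD.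
by apply: leeD => //; apply: leeD; exact: int_sum.
Qed.

(** * Constants of the risk bound *)

Section Constants.
Context {R : realType}.
Implicit Types eta K L : R.

(** Coefficient of [s^2 n] in the exponent of the moment bound for sums of deviations. *)
Definition mgf_const eta K := 16 * moment_const eta K / eta ^+ 2.
(** In units of [r]: 1 for the shift [r I], and [2 K / eta] for the term of order [1 / n] in the
    sample covariance. *)
Definition bias_const eta K := 1 + 2 * (K / eta).
(** Divided by [p M], this is the radius of the good event. *)
Definition radius_const eta K := eta / (16 * K).
(** The optimal Chernoff exponent at radius [x] is [n x^2 / (4 c)] with [c = mgf_const eta K]; at
    the radius of the good event it equals [n / (rate_const * p^2 M^2)]. *)
Definition rate_const eta K := 4 * mgf_const eta K / radius_const eta K ^+ 2.
(* [level_const] solves [eta B = c eta^2 + 2] with [c = mgf_const eta K], so that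
   the factor [expR (- (eta * ln p * B))] cancels [p^2 expR (c eta^2 ln p)]. *)
Definition level_const eta K := mgf_const eta K * eta + 2 / eta.
(** The first term lets the tolerance control the bias; the second makes the Chernoff exponent at
    least [12 ln p]. *)
Definition tau_threshold eta K := 4 * bias_const eta K + 12 * rate_const eta K + 1.
(** The first two summands come from the constant part of the pointwise bound, the third from the
    tilted exponentials and the last from the bad event. *)
Definition risk_const eta K L :=
  32 ^+ 2 * level_const eta K ^+ 2 + 2 * (4 * bias_const eta K + L) ^+ 2
  + 256 ^+ 2 / eta ^+ 2 + (2048 * rate_const eta K ^+ 2 + 32 * rate_const eta K).

End Constants.

(** * The risk at fixed sample size and dimension *)

Section Risk.
Context {d : measure_display} {T : measurableType d} {R : realType}.
Variable P : probability T R.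
Context {p n : nat}.
Variables (X : {RV P >-> p.-tuple R}) (mu : 'cV[R]_p).
Variables (Xs : 'I_n -> {RV P >-> p.-tuple R}).
Variables (S Om : 'M[R]_p) (eta K M L rho : R).
Hypotheses (p2 : (2 <= p)%N) (n2 : (2 <= n)%N) (eta0 : 0 < eta) (eta4 : eta < 1 / 4).
Hypotheses (meanX : is_mean X mu) (covX : is_covariance X S) (tailX : exp_tails X mu eta K).
Hypotheses (iidXs : iid_sample X Xs) (SOm : S *m Om = 1%:M).
Hypotheses (sOm : Om^T = Om) (OmM : normL1 Om <= M) (rho1 : 1 <= rho).

Let r : R := Num.sqrt (log_rate p n).
Let l : R := ln p%:R.
Let q : R := p%:R.
Let N : R := n%:R.

Hypotheses (rate_le : log_rate p n <= eta) (tauL : tau_threshold eta K <= L).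
Hypothesis lambda_lt : L * M * r < p%:R^-1.

Let q2 : 2 <= q. Proof. by rewrite /q (ler_nat R 2 p). Qed.
Let N2 : 2 <= N. Proof. by rewrite /N (ler_nat R 2 n). Qed.
Let q0 : 0 < q. Proof. have := q2; lra. Qed.
Let N0 : 0 < N. Proof. have := N2; lra. Qed.
Let l12 : 1 / 2 <= l. Proof. exact: ln_nat_ge_half. Qed.
Let l0 : 0 < l. Proof. have := l12; lra. Qed.
Let expl : expR l = q. Proof. by rewrite lnK// posrE q0. Qed.
Let r2E : r ^+ 2 = log_rate p n.
Proof. by rewrite sqr_sqrtr// /log_rate divr_ge0// ltW. Qed.
Let rN : r ^+ 2 * N = l.
Proof. by rewrite r2E /log_rate divfK// gt_eqF. Qed.
Let r0 : 0 < r. Proof. by rewrite sqrtr_gt0 divr_gt0. Qed.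
Let r12 : r <= 1 / 2.
Proof.
rewrite -(@ler_pXn2r _ 2)// ?nnegrE ?(ltW r0)//.
have := rate_le; have := eta4; rewrite r2E expr2; lra.
Qed.

Let K1 : 1 <= K. Proof. exact: tail_const_ge1 eta0 tailX (Ordinal (ltnW p2)). Qed.
Let K0 : 0 < K. Proof. have := K1; lra. Qed.

Let covS i j : `|S i j| <= K / eta.
Proof. exact: (covariance_abs_le meanX covX eta0 tailX i j). Qed.

(** An entry 1 of [S Om] is at most [|S|] times the L1 norm of [Om], which keeps [M] away from 0. *)
Let eta_le : eta <= K * M.
Proof.
pose i := Ordinal (ltnW p2); have Keta : 0 <= K / eta by rewrite divr_ge0// ltW.
have : 1 <= (K / eta) * M.
  apply: (@le_trans _ _ `|S *m Om|).
    by rewrite SOm; have := le_mx_norm (1%:M : 'M[R]_p) i i; rewrite mxE eqxx normr1.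
  apply: le_trans (mx_norm_mulr _ _) _.
  by rewrite ler_pM ?normL1_ge0//; apply: mx_norm_le.
by rewrite mulrAC ler_pdivlMr// mul1r.
Qed.

Let M0 : 0 < M. Proof. by rewrite -(pmulr_rgt0 _ K0); apply: lt_le_trans eta_le. Qed.

Let c := mgf_const eta K.
Let G := rate_const eta K.
Let kap := radius_const eta K.
Let B := level_const eta K.
Let c3 := bias_const eta K.

Let c16 : 16 <= c * eta.
Proof.
have m1 : 1 <= moment_const eta K.
  rewrite /moment_const -[1]mulr1 ler_pM//.
  apply: le_trans (expR_ge1Dx _); rewrite lerDl.
  by rewrite mulr_ge0 ?addr_ge0 ?divr_ge0 ?(ltW eta0) ?(ltW K0).
have -> : c * eta = 16 * moment_const eta K / eta.
  by rewrite /c /mgf_const; field; rewrite gt_eqF.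
rewrite ler_pdivlMr//; have := eta4; have := m1; lra.
Qed.

Let c0 : 0 < c. Proof. by rewrite -(pmulr_lgt0 _ eta0); have := c16; lra. Qed.
Let kap0 : 0 < kap. Proof. by rewrite /kap /radius_const divr_gt0// mulr_gt0. Qed.
Let G0 : 0 < G. Proof. by rewrite /G /rate_const divr_gt0 ?exprn_gt0// mulr_gt0. Qed.
Let B0 : 0 <= B.
Proof. by rewrite /B /level_const addr_ge0// ?(mulr_ge0 (ltW c0)) ?divr_ge0 ?(ltW eta0). Qed.
Let c31 : 1 <= c3.
Proof. by rewrite /c3 /bias_const lerDl mulr_ge0// divr_ge0 ?(ltW K0) ?(ltW eta0). Qed.
Let L_ge : 4 * c3 + 12 * G + 1 <= L. Proof. exact: tauL. Qed.
Let L0 : 0 < L. Proof. have := L_ge; have := c31; have := G0; lra. Qed.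

Let lambda := L * M * r.
Let lambda0 : 0 <= lambda.
Proof. by rewrite /lambda !mulr_ge0 ?(ltW L0) ?(ltW M0) ?(ltW r0). Qed.
Let lambdaq : q * lambda < 1.
Proof. by rewrite -ltr_pdivlMl// mulr1; exact: lambda_lt. Qed.
Let lambda1 : lambda <= 1.
Proof.
by apply: ltW; apply: lt_trans lambda_lt _; rewrite invf_lt1 -/q//; have := q2; lra.
Qed.

(** On the good event all averaged deviations are at most [x]. *)
Let x := kap / (q * M).
Let qM0 : 0 < q * M. Proof. exact: mulr_gt0. Qed.
Let x0 : 0 < x. Proof. by rewrite /x divr_gt0. Qed.
Let x1 : x <= 1 / 16.
Proof.
rewrite /x ler_pdivrMr// /kap /radius_const invfM mulrA ler_pdivrMr//.
have : eta * 2 <= K * M * q by rewrite ler_pM// ?ltW.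
have := eta0; lra.
Qed.

(** The minimizer of [c s^2 - s x], that is, the optimal Chernoff parameter. *)
Let sx := x / (2 * c).
Let sx0 : 0 < sx. Proof. by rewrite /sx divr_gt0// mulr_gt0. Qed.
Let sx_le : sx <= eta / 2.
Proof.
rewrite /sx (ler_pdivrMr _ _ (mulr_gt0 (ltr0Sn R 1) c0)).
have -> : eta / 2 * (2 * c) = c * eta by field.
by have := c16; have := x1; lra.
Qed.

Let dev a w := `|\sum_k deviation mu S a (Xs k w)|.
Let A w := sample_cov Xs w + r%:M.
Let err w := `|giss_estimator rho lambda (A w) - Om|.

Let coerciveA w (v : 'cV[R]_p) : r * sqnorm2 v <= (v^T *m A w *m v) ord0 ord0.
Proof. by apply: sample_cov_coercive; exact: ltnW. Qed.

Lemma perturbation_le w (z : R) : 0 <= z <= 1 -> (forall a, dev a w <= N * z) ->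
  `|A w - S| <= 4 * z + c3 * r.
Proof.
move=> z01 dz; have [z0 _] := andP z01.
apply: mx_norm_le => [|i j]; first by rewrite addr_ge0 ?mulr_ge0 ?(ltW r0) ?(le_trans ler01 c31).
have -> : (A w - S) i j = sample_cov Xs w i j - S i j + r *+ (i == j).
  by rewrite mxE [X in X + _]mxE [(- S) i j]mxE [r%:M i j]mxE addrAC.
have h1 := sample_cov_error n2 z01 (covS i j) dz.
have h2 : `|r *+ (i == j)| <= r by case: (i == j); rewrite ?mulr1n ?mulr0n ?normr0 ?ger0_norm// ltW.
apply: le_trans (ler_normD _ _) _; apply: le_trans (lerD h1 h2) _.
(* [1 / N = r^2 / l] and [r <= 1/2 <= l], so terms of order [1 / N] are absorbed into the rate. *)
have NV : N^-1 <= r.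
  have -> : N^-1 = r ^+ 2 / l by rewrite -rN; field; rewrite !gt_eqF.
  rewrite ler_pdivrMr// expr2 ler_wpM2l ?(ltW r0)//; have := r12; have := l12; lra.
have : 2 * (K / eta) / N <= 2 * (K / eta) * r.
  by rewrite ler_wpM2l// mulr_ge0// divr_ge0 ?(ltW K0) ?(ltW eta0).
rewrite /c3 /bias_const -/N; lra.
Qed.

Lemma error_le_good w (z : R) : 0 <= z <= x -> (forall a, dev a w <= N * z) ->
  err w ^+ 2 <= M ^+ 4 * (512 * z ^+ 2 + 2 * (4 * c3 + L) ^+ 2 * r ^+ 2).
Proof.
move=> /andP[z0 zx] dz.
have z01 : 0 <= z <= 1 by rewrite z0 /=; apply: le_trans zx _; have := x1; lra.
have dA := perturbation_le z01 dz.
have qMx : q * M * z <= 1 / 64.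
  apply: (@le_trans _ _ (q * M * x)); first by rewrite ler_wpM2l ?(ltW qM0).
  have -> : q * M * x = kap by rewrite /x; field; rewrite !gt_eqF.
  rewrite /kap /radius_const ler_pdivrMr ?mulr_gt0//; have := K1; have := eta4; lra.
(* As [4 c3 <= L], the bias is controlled by [q lambda < 1]. With [qMx] this bounds the perturbation
   by 1/16 + 1/4. *)
have qMr : 4 * (q * M * (c3 * r)) <= 1.
  have : 4 * c3 * (q * M * r) <= L * (q * M * r).
    by rewrite ler_wpM2r ?mulr_ge0 ?ltW//; have := L_ge; have := G0; lra.
  have := lambdaq; rewrite /lambda; lra.
have small : q * (M * `|A w - S|) <= 1 / 2.
  apply: (@le_trans _ _ (q * M * (4 * z + c3 * r))); last by lra.
  by rewrite mulrA ler_wpM2l ?(ltW qM0).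
have le1 := giss_estimator_good r0 rho1 lambda0 (coerciveA w) sOm OmM (ltW lambdaq) SOm small.
have le2 : err w <= M ^+ 2 * (16 * z + (4 * c3 + L) * r).
  apply: le_trans le1 _.
  have -> : M ^+ 2 * (16 * z + (4 * c3 + L) * r) =
      M * (4 * M * (4 * z + c3 * r) + lambda) by rewrite /lambda; ring.
  by rewrite ler_wpM2l ?(ltW M0)// lerD2r ler_wpM2l// mulr_ge0 ?(ltW M0).
have e0 : 0 <= err w by exact: normr_ge0.
apply: (@le_trans _ _ ((M ^+ 2 * (16 * z + (4 * c3 + L) * r)) ^+ 2)).
  by rewrite ler_pXn2r// nnegrE// (le_trans e0).
rewrite exprMn -exprM ler_wpM2l ?exprn_ge0 ?(ltW M0)//.
have := sqr_ge0 (16 * z - (4 * c3 + L) * r); rewrite !expr2; lra.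
Qed.

Lemma error_le_bad w : err w ^+ 2 <= 8 / r ^+ 2 + 2 * M ^+ 2.
Proof.
have le1 := giss_estimator_crude r0 rho1 lambda0 (coerciveA w) sOm OmM (ltW lambdaq) lambda1.
apply: (@le_trans _ _ ((2 / r + M) ^+ 2)).
  by rewrite ler_pXn2r// nnegrE ?normr_ge0// addr_ge0 ?divr_ge0// ltW.
have -> : 8 / r ^+ 2 = 2 * (2 / r) ^+ 2 by field; rewrite gt_eqF.
have := sqr_ge0 (2 / r - M); rewrite !expr2; lra.
Qed.

(** Coefficients of the pointwise bound: [k0] and [k1] come from the good event, while [k2] is the
    crude error times the Chernoff factor. *)
Let k0 := M ^+ 4 * r ^+ 2 * (32 ^+ 2 * B ^+ 2 + 2 * (4 * c3 + L) ^+ 2).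
Let k1 := M ^+ 4 * r ^+ 2 * (64 ^+ 2 / (eta * l) ^+ 2 * expR (- (eta * l * B))).
Let k2 := (8 / r ^+ 2 + 2 * M ^+ 2) * expR (- (sx * N * x)).
Let F1 a w := expR (eta * r * dev a w).
Let F2 a w := expR (sx * dev a w).

Let Mr0 : 0 <= M ^+ 4 * r ^+ 2.
Proof. by apply: mulr_ge0; apply: exprn_ge0; apply: ltW. Qed.
Let e10 : 0 <= 8 / r ^+ 2 + 2 * M ^+ 2.
Proof.
apply: addr_ge0; last by apply: mulr_ge0 => //; exact: sqr_ge0.
by apply: divr_ge0 => //; exact: sqr_ge0.
Qed.
Let k00 : 0 <= k0.
Proof.
apply: (mulr_ge0 Mr0); apply: addr_ge0; apply: mulr_ge0 => //; exact: sqr_ge0.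
Qed.
Let k10 : 0 <= k1.
Proof.
apply: (mulr_ge0 Mr0); apply: mulr_ge0; last exact: expR_ge0.
by apply: divr_ge0; exact: sqr_ge0.
Qed.
Let k20 : 0 <= k2. Proof. by apply: (mulr_ge0 e10); exact: expR_ge0. Qed.

(** Split according to whether the largest averaged deviation [D] is at most [x]. If so, the sharp
    bound applies and [D^2] is tilted; otherwise a single term of the last sum dominates the crude
    bound. *)
Lemma error_le w : err w ^+ 2 <= k0 + k1 * (\sum_a F1 a w) + k2 * (\sum_a F2 a w).
Proof.
have sF1 : 0 <= \sum_a F1 a w by rewrite sumr_ge0// => a _; exact: expR_ge0.
have sF2 : 0 <= \sum_a F2 a w by rewrite sumr_ge0// => a _; exact: expR_ge0.
pose D : R := \big[Num.max/0]_a (dev a w / N).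
have devD a : dev a w <= N * D.
  by rewrite mulrC -ler_pdivrMr// /D (le_bigmax 0 (fun a => dev a w / N) a).
have D0 : 0 <= D.
  rewrite /D; elim/big_ind: _ => [//|y z y0 z0|a _]; first by rewrite le_max y0.
  by apply: divr_ge0; [exact: normr_ge0|exact: ltW].
have [Dx|xD] := leP D x.
  apply: le_trans (error_le_good (z := D) _ devD) _; first by rewrite D0.
  apply: (@le_trans _ _ (k0 + k1 * \sum_a F1 a w)); last first.
    by rewrite lerDl; exact: (mulr_ge0 k20).
  have D2 : D ^+ 2 <= r ^+ 2 * (2 * B ^+ 2
      + 8 / (eta * l) ^+ 2 * expR (- (eta * l * B)) * \sum_a F1 a w).
    have e0 : 0 <= 8 / (eta * l) ^+ 2 * expR (- (eta * l * B)).
      by rewrite mulr_ge0 ?expR_ge0// divr_ge0// sqr_ge0.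
    (* The bound passes from each average to the maximum, which is 0 or one of them. *)
    rewrite /D; elim/big_ind: _ => [|y z hy hz|a _].
    - rewrite expr0n/=; apply: mulr_ge0; first exact: sqr_ge0.
      apply: addr_ge0; last exact: (mulr_ge0 e0).
      by apply: mulr_ge0 => //; exact: sqr_ge0.
    - by rewrite /Num.max; case: ifP.
    apply: le_trans (sqr_le_exp_tilt r0 N0 rN l0 eta0 B0 (normr_ge0 _)) _.
    rewrite ler_wpM2l ?sqr_ge0// lerD2l ler_wpM2l//.
    by rewrite (bigD1 a)//= lerDl sumr_ge0// => b _; exact: expR_ge0.
  have -> : k0 + k1 * (\sum_a F1 a w) = M ^+ 4 * (512 * (r ^+ 2 * (2 * B ^+ 2
      + 8 / (eta * l) ^+ 2 * expR (- (eta * l * B)) * \sum_a F1 a w))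
      + 2 * (4 * c3 + L) ^+ 2 * r ^+ 2) by rewrite /k0 /k1; ring.
  apply: ler_wpM2l; first by apply: exprn_ge0; exact: ltW.
  by rewrite lerD2r; apply: (ler_wpM2l _ D2); exact: ler0n.
have [a xa] : exists a, x < dev a w / N.
  apply/not_existsP => no; move: xD; apply/negP; rewrite -leNgt.
  by apply: bigmax_le => [|a _]; [exact: ltW|rewrite leNgt; apply/negP].
apply: le_trans (error_le_bad w) _.
apply: (@le_trans _ _ (k2 * \sum_a F2 a w)); last first.
  by rewrite lerDr; apply: (addr_ge0 k00); exact: (mulr_ge0 k10).
rewrite /k2 -mulrA ler_peMr//.
rewrite (bigD1 a)//= mulrDr; apply: (@le_trans _ _ (expR (- (sx * N * x)) * F2 a w)).
  (* Markov's inequality, pointwise: [N x <= dev a w] makes the exponential at least 1. *)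
  rewrite /F2 -expRD -[leLHS]expR0 ler_expR.
  have : N * x <= dev a w by rewrite mulrC -ler_pdivlMr// ltW.
  move=> /(ler_wpM2l (ltW sx0)); lra.
by rewrite lerDl mulr_ge0 ?expR_ge0// sumr_ge0// => b _; exact: expR_ge0.
Qed.

Lemma risk_le :
  (\int[P]_w (err w ^+ 2)%:E <= (risk_const eta K L * (M ^+ 4 * log_rate p n))%:E)%E.
Proof.
have mdev (s : R) a : measurable_fun setT (fun w => expR (s * dev a w)).
  apply: measurable_expR_norm; apply: measurable_sum => k.
  by apply: measurableT_comp => //; exact: measurable_deviation.
have moment a (s : R) : 0 <= s <= eta / 2 ->
    (\int[P]_w (expR (s * dev a w))%:E <= (2 * expR (c * s ^+ 2 * N))%:E)%E.
  exact: (deviation_sum_moment meanX covX eta0 tailX a iidXs).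
have h1 a : (\int[P]_w (F1 a w)%:E <= (2 * expR (c * (eta * r) ^+ 2 * N))%:E)%E.
  apply: moment; rewrite mulr_ge0 ?(ltW eta0) ?(ltW r0)//=.
  by have := r12; rewrite div1r => h; rewrite ler_wpM2l ?(ltW eta0).
have h2 a : (\int[P]_w (F2 a w)%:E <= (2 * expR (c * sx ^+ 2 * N))%:E)%E.
  by apply: moment; rewrite sx_le ltW.
apply: le_trans (integral_le_sum2 k00 k10 k20 (mdev _) (mdev _)
  (fun a w => expR_ge0 _) (fun a w => expR_ge0 _) h1 h2 (fun w => sqr_ge0 _) error_le) _.
rewrite lee_fin -r2E.
(* There are [p (p + 1)] deviations. *)
have cardI : #|{: 'I_p * option 'I_p}|%:R <= 2 * q ^+ 2.
  rewrite card_prod card_option card_ord natrM -(addn1 p) natrD -/q.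
  have := q2; rewrite !expr2; nra.
have bound1 : k1 * (#|{: 'I_p * option 'I_p}|%:R * (2 * expR (c * (eta * r) ^+ 2 * N)))
    <= 256 ^+ 2 / eta ^+ 2 * (M ^+ 4 * r ^+ 2).
  apply: (@le_trans _ _ (k1 * (2 * q ^+ 2 * (2 * expR (c * (eta * r) ^+ 2 * N))))).
    by rewrite ler_wpM2l// ler_wpM2r// mulr_ge0 ?expR_ge0.
  have tilt : expR (- (eta * l * B)) * (q ^+ 2 * expR (c * (eta * r) ^+ 2 * N)) = 1.
    rewrite -expl -expRM_natl -!expRD -[RHS]expR0; congr expR.
    by rewrite /B /level_const -rN -/c; field; rewrite gt_eqF.
  have -> : k1 * (2 * q ^+ 2 * (2 * expR (c * (eta * r) ^+ 2 * N))) =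
      M ^+ 4 * r ^+ 2 * (128 ^+ 2 / eta ^+ 2) * (l^-1) ^+ 2.
    rewrite -[RHS]mulr1 -[X in _ = _ * X]tilt /k1; field; rewrite !gt_eqF//.
  have -> : 256 ^+ 2 / eta ^+ 2 * (M ^+ 4 * r ^+ 2) =
      M ^+ 4 * r ^+ 2 * (128 ^+ 2 / eta ^+ 2) * 2 ^+ 2 by ring.
  apply: ler_wpM2l.
    by apply: (mulr_ge0 Mr0); apply: divr_ge0; exact: sqr_ge0.
  rewrite ler_pXn2r ?nnegrE ?invr_ge0 ?(ltW l0)//.
  rewrite -[leRHS]invrK lef_pV2 ?posrE ?invr_gt0//; have := l12; lra.
pose u := N / (G * q ^+ 2 * M ^+ 2).
have u12 : 12 * l <= u.
  have GqM : 0 < G * q ^+ 2 * M ^+ 2.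
    by apply: mulr_gt0; [apply: (mulr_gt0 G0)|]; exact: exprn_gt0.
  rewrite /u (ler_pdivlMr _ _ GqM) -rN.
  (* The hypothesis on the tolerance bounds [(q M r)^2] by [1 / L^2], hence by [1 / (12 G)]. *)
  have lam2 : (q * (L * M * r)) ^+ 2 <= 1.
    by rewrite exprn_ile1// ?(ltW lambdaq)// mulr_ge0 ?lambda0 ?ltW.
  have L2 : 12 * G <= L ^+ 2.
    have L1 : 1 <= L by have := L_ge; have := c31; have := G0; lra.
    apply: (@le_trans _ _ L); first by have := L_ge; have := c31; lra.
    by rewrite expr2 ler_peMr// (le_trans ler01).
  have -> : 12 * (r ^+ 2 * N) * (G * q ^+ 2 * M ^+ 2) = (12 * G) * (q * M * r) ^+ 2 * N by ring.
  rewrite -[leRHS]mul1r ler_wpM2r ?(ltW N0)//.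
  apply: le_trans lam2.
  have -> : (q * (L * M * r)) ^+ 2 = L ^+ 2 * (q * M * r) ^+ 2 by ring.
  by rewrite ler_wpM2r// sqr_ge0.
have bound2 : k2 * (#|{: 'I_p * option 'I_p}|%:R * (2 * expR (c * sx ^+ 2 * N)))
    <= (2048 * G ^+ 2 + 32 * G) * (M ^+ 4 * r ^+ 2).
  apply: le_trans (bad_event_numerics N0 expl r0 rN l12 G0 M0 (erefl u) u12).
  (* At the optimal parameter, [- sx N x + c sx^2 N = - N x^2 / (4 c) = - u]. *)
  have -> : expR (- u) = expR (- (sx * N * x)) * expR (c * sx ^+ 2 * N).
    rewrite -expRD; congr expR; rewrite /u /sx /x /G /rate_const -/c -/kap.
    by field; rewrite !gt_eqF.
  rewrite /k2 -mulrA; apply: (ler_wpM2l e10).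
  rewrite [leRHS]mulrCA ler_wpM2l ?expR_ge0//.
  have -> : 4 * q ^+ 2 * expR (c * sx ^+ 2 * N) = 2 * q ^+ 2 * (2 * expR (c * sx ^+ 2 * N)) by ring.
  by rewrite ler_wpM2r// mulr_ge0 ?expR_ge0.
rewrite /risk_const -/c3 -/B -/G.
have k0E : k0 = (32 ^+ 2 * B ^+ 2 + 2 * (4 * c3 + L) ^+ 2) * (M ^+ 4 * r ^+ 2).
  by rewrite /k0; ring.
rewrite [leRHS]mulrDl; apply: lerD; last exact: bound2.
rewrite [leRHS]mulrDl; apply: lerD; last exact: bound1.
by rewrite k0E.
Qed.

End Risk.

(** Taking [tau] large thus puts the tolerance constant itself above [tau_threshold]. *)
Lemma tail_const_ge (R : realType) (eta K tau : R) :
  0 < eta < 1 / 4 -> 0 <= tau -> tau <= tail_const eta K tau.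
Proof.
move=> /andP[eta0 eta4] tau0; rewrite /tail_const.
set b := eta^-1 * _ * _; have b0 : 0 <= b.
  apply: mulr_ge0; last exact: sqr_ge0.
  by apply: mulr_ge0; [rewrite invr_ge0 ltW|exact: sqr_ge0].
have h1 : 1 <= eta ^- 2 by rewrite invf_ge1 ?exprn_gt0// exprn_ile1 ?(ltW eta0)//; lra.
have h2 : tau <= (2 + tau + b) ^+ 2.
  have := sqr_ge0 (tau + b); rewrite !expr2; nra.
have : (2 + tau + b) ^+ 2 <= eta ^- 2 * (2 + tau + b) ^+ 2 by rewrite ler_peMl ?sqr_ge0.
have := sqr_ge0 (2 + tau + b); lra.
Qed.

Theorem theorem4p2 (R : realType) (q eta K Xi : R)
    (hq : 0 <= q < 1) (heta : 0 < eta < 1 / 4) (hXi : 0 <= Xi) :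
  exists tau0 : R, forall tau : R, tau0 <= tau ->
  forall (rho : R) (p : nat -> nat) (M : nat -> R) (s0 : nat -> R),
  let gamma (n : nat) : R := Num.sqrt (log_rate (p n) n) in
  let lambda (n : nat) : R :=
    tail_const eta K tau * M n * Num.sqrt (log_rate (p n) n) in
  1 <= rho ->
  (\forall n \near \oo,
    [/\ (2 <= p n)%N,
        n%:R `^ Xi <= (p n)%:R,
        log_rate (p n) n <= eta &
        exists2 varrho : R, 0 < varrho &
          lambda n < (p n)%:R^-1 - varrho]) ->
  exists C : R, \forall n \near \oo,
    (ereal_sup (giss_risks n (p n) q (s0 (p n)) (M n) eta K rho
                  (lambda n) (gamma n))
     <= (C * (M n ^+ 4 * log_rate (p n) n))%:E)%E.
Proof.
exists (Num.max 0 (tau_threshold eta K)) => tau.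
rewrite ge_max => /andP[tau0 tauT] rho p M s0 gamma lambda rho1 hyp.
have tauL : tau_threshold eta K <= tail_const eta K tau.
  exact: le_trans tauT (tail_const_ge K heta tau0).
have [eta0 eta4] := andP heta.
(* This constant depends on [eta], [K] and [tau] only, hence is uniform over the class, the laws and
   [n]. *)
exists (risk_const eta K (tail_const eta K tau)).
near=> n.
have n2 : (2 <= n)%N by near: n; exact: nbhs_infty_ge.
have [p2 _ rate [varrho varrho0 lam]] : [/\ (2 <= p n)%N, n%:R `^ Xi <= (p n)%:R,
    log_rate (p n) n <= eta & exists2 varrho : R, 0 < varrho &
      lambda n < (p n)%:R^-1 - varrho] by near: n.
have lam1 : lambda n < (p n)%:R^-1 by apply: lt_trans lam _; rewrite ltrBlDr ltrDl.
apply: ge_ereal_sup => _ [Om [[sOm _] OmM _] [d [T [P [X [mu [Xs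
  [meanX [S [covX uS OmE]] tailX iid ->]]]]]]]].
have SOm : S *m Om = 1%:M by rewrite OmE mulmxV.
rewrite unlock.
exact: (risk_le p2 n2 eta0 eta4 meanX covX tailX iid SOm sOm OmM rho1 rate tauL lam1).
Unshelve. all: by end_near.
Qed.
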